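(* Let $n=\dim M>2$ and let $L\to\widetilde L$ be a projective change of Finsler structures on $M$ with projective factor $\lambda$ ($\widetilde G=G-2\lambda\,\mathcal C$) satisfying $$Q(\overline X)=\frac1{n+1}R_1(\overline X)\quad\text{for all }\pi\text{-vector fields }\overline X .$$ Then $(M,L)$ is $h$-projectively flat under this change (i.e. the $h$-curvature tensor $\widetilde R^\circ$ of the Berwald connection of $(M,\widetilde L)$ vanishes) if, and only if, the Weyl torsion tensor $W_2$ of $(M,L)$ vanishes.
   Context: $M$ is a real paracompact $C^\infty$ manifold of dimension $n$; $\pi:\mathcal TM\to M$ is the bundle of nonzero tangent vectors; $\pi^{-1}(TM)\to\mathcal TM$ is the pullback of $TM$ by $\pi$. Sections of $\pi^{-1}(TM)$ are called $\pi$-vector fields and written $\overline X$; tensor fields on $\pi^{-1}(TM)$ are called $\pi$-tensor fields (scalar-valued covariant ones: $\pi$-forms). $\overline\eta$ is the $\pi$-vector field $\overline\eta(u)=(u,u)$. There is an exact sequence $0\to\pi^{-1}(TM)\xrightarrow{\gamma}T(\mathcal TM)\xrightarrow{\rho}\pi^{-1}(TM)\to0$, where $\gamma$ is the vertical lift $\gamma(u,w)=\frac{d}{dt}\big|_{t=0}(u+tw)$ and $\rho$ sends $X\in T_u(\mathcal TM)$ to $(u,d\pi(X))$. Put $J:=\gamma\circ\rho$ and $\mathcal C:=\gamma\circ\overline\eta$. For a function $f$, $d_Jf(X)=(JX)\cdot f$. For a Finsler manifold $(M,L)$ with $E=\frac12L^2$: the canonical spray $G$ is the vector field with $i_G\,dd_JE=-dE$;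 the Barthel connection is $\Gamma=[J,G]$, i.e. $\Gamma(X)=[JX,G]-J[X,G]$; $h=\frac12(I+\Gamma)$, $v=\frac12(I-\Gamma)$. The horizontal map $\beta:\pi^{-1}(TM)\to T(\mathcal TM)$ sends $\overline X$ to the unique vector in the image of $h$ with $\rho(\beta\overline X)=\overline X$; $K:T(\mathcal TM)\to\pi^{-1}(TM)$ is determined by $\gamma\circ K=v$. The Berwald connection $D^\circ$ is the linear connection on $\pi^{-1}(TM)$ with $D^\circ_{\gamma\overline X}\overline Y=\rho[\gamma\overline X,\beta\overline Y]$ and $D^\circ_{\beta\overline X}\overline Y=K[\beta\overline X,\gamma\overline Y]$. Curvature: $\mathbf K(X,Y)\overline Z=-D^\circ_XD^\circ_Y\overline Z+D^\circ_YD^\circ_X\overline Z+D^\circ_{[X,Y]}\overline Z$; $R^\circ(\overline X,\overline Y)\overline Z=\mathbf K(\beta\overline X,\beta\overline Y)\overline Z$; $\widehat R^\circ(\overline X,\overline Y)=R^\circ(\overline X,\overline Y)\overline\eta$. Further $R_2(\overline X,\overline Y):=\mathrm{Tr}\{\overline Z\mapsto R^\circ(\overline X,\overline Z)\overline Y\}$ and $R_1(\overline X):=\frac1{n-1}\{nR_2(\overline X,\overline\eta)+R_2(\overline\eta,\overline X)\}$. Weyl torsion tensor: $W_2(\overline X,\overline Y):=\widehat R^\circ(\overline X,\overline Y)+\frac1{n+1}\mathfrak U_{\overline X,\overline Y}\{R_1(\overline Y)\overline X+(D^\circ_{\gamma\overline X}R_1)(\overline Y)\overline\eta\}$, with $\mathfrak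 U_{\overline X,\overline Y}\{A(\overline X,\overline Y)\}:=A(\overline X,\overline Y)-A(\overline Y,\overline X)$. Projective change: a change $L\to\widetilde L$ of Finsler structures on $M$ whose canonical sprays satisfy $\widetilde G=G-2\lambda\mathcal C$ for a function $\lambda$ on $TM$ (smooth on $\mathcal TM$) positively homogeneous of degree 1 in $y$. Put $\alpha(\overline X):=d_J\lambda(\beta\overline X)$ and $Q(\overline X):=\beta\overline X\cdot\lambda-\lambda\,\alpha(\overline X)$. Tilded objects are those of $(M,\widetilde L)$, untilded ones those of $(M,L)$. *)

(* Defs.v *)
From HB Require Import structures.
From mathcomp Require Import all_boot all_order all_algebra.
From mathcomp Require Import all_classical all_reals all_analysis.

Set Implicit Arguments.
Unset Strict Implicit.
Unset Printing Implicit Defensive.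

Import Order.TTheory GRing.Theory Num.Theory numFieldNormedType.Exports.

Local Open Scope classical_set_scope.
Local Open Scope ring_scope.

(* [Ck k U f]: f is of class C^k on the open set U of a finite-dimensional V. *)
Fixpoint Ck (R : realType) (V : normedModType R) (k : nat) (U : set V)
    (f : V -> R) : Prop :=
  match k with
  | 0 => forall x, U x -> {for x, continuous f}
  | k'.+1 => (forall x, U x -> differentiable f x)
             /\ forall v : V, Ck k' U ('D_v f)
  end.

Definition smooth_near (R : realType) (V : normedModType R) (x : V)
    (f : V -> R) : Prop :=
  exists U : set V, [/\ open U, U x & forall k, Ck k U f].

Definition paracompact_space (T : topologicalType) : Prop :=
  forall C : set (set T),
    (forall U, C U -> open U) -> (forall p, exists2 U, C U & U p) ->
  exists D : set (set T),
    [/\ forall V, D V -> open V,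
        forall p, exists2 V, D V & V p,
        forall V, D V -> exists2 U, C U & V `<=` U
      & forall p : T, exists2 N : set T, nbhs p N &
          finite_set [set V | D V /\ (V `&` N) !=set0]].

(* [chart_param i] is the inverse of [coord i]; only the values of [coord i]
   on [chart_dom i], and of [chart_param i] on its image, are meaningful. *)
Record manifold (R : realType) (n : nat) := Manifold {
  carrier :> topologicalType;
  chart : Type;
  chart_dom : chart -> set carrier;
  coord : chart -> carrier -> 'rV[R]_n;
  chart_param : chart -> 'rV[R]_n -> carrier;
  chart_dom_open : forall i, open (chart_dom i);
  chart_img_open : forall i, open (coord i @` chart_dom i);
  coordK : forall i p, chart_dom i p -> chart_param i (coord i p) = p;
  coord_continuous : forall i p, chart_dom i p ->
    {for p, continuous (coord i)};
  param_continuous : forall i p, chart_dom i p ->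
    {for coord i p, continuous (chart_param i)};
  chart_cover : forall p, exists i, chart_dom i p;
  transition_smooth : forall i j p, chart_dom i p -> chart_dom j p ->
    forall k, smooth_near (coord i p)
      (fun x => coord j (chart_param i x) ord0 k);
  manifold_hausdorff : hausdorff_space carrier;
  manifold_paracompact : paracompact_space carrier
}.

(* A set with local parametrizations [param i : pdom i -> pt] by open subsets
   of a normed space; M, TM and the slit bundle are all treated as instances,
   so that smooth functions and tangent vectors are defined once for all.
   The points of the space are those in the image of some parametrization. *)
Record pspace (R : realType) := PSpace {
  pt :> Type;
  pix : Type;
  model : normedModType R;
  pdom : pix -> set model;
  param : pix -> model -> pt
}.

Section Pspace.
Context {R : realType} (P : pspace R).

Definition points : set P :=
  [set p | exists i x, pdom i x /\ param i x = p].

(* smooth on a neighbourhood of p *)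
Definition smooth_at (p : P) (g : P -> R) : Prop :=
  forall i x, pdom i x -> param i x = p -> smooth_near x (g \o param i).

(* Tangent vectors are directional derivative operators.  They are set to 0 on
   functions that are not smooth at the base point, so that tangent vectors
   with the same action on smooth germs are equal. *)
Definition der := (P -> R) -> R.

Definition on_smooth (p : P) (v : der) : der :=
  fun g => if `[< smooth_at p g >] then v g else 0.

Definition dirder (i : pix P) (x a : model P) : der :=
  on_smooth (param i x) (fun g => 'D_a (g \o param i) x).

Definition tangent (p : P) : set der :=
  [set v | exists i x a, [/\ pdom i x, param i x = p & v = dirder i x a]].

Definition vfield := P -> der.

Definition smooth_vfield (X : vfield) : Prop :=
  forall u, points u -> tangent u (X u) /\
    forall f, smooth_at u f -> smooth_at u (fun w => X w f).

Definition bracket (X Y : vfield) : vfield := fun u =>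
  on_smooth u (fun f => X u (fun w => Y w f) - Y u (fun w => X w f)).

(* exterior derivative of a 1-form *)
Definition ext_d (omega : vfield -> P -> R) (X Y : vfield) (u : P) : R :=
  X u (omega Y) - Y u (omega X) - omega (bracket X Y) u.

End Pspace.

Definition base {R : realType} {n : nat} (M : manifold R n) : pspace R :=
  @PSpace R M (chart M) 'rV[R]_n
    (fun i => coord i @` chart_dom i) (@chart_param R n M).

Definition TM_param {R : realType} {n : nat} (M : manifold R n) (i : chart M)
    (z : 'rV[R]_n * 'rV[R]_n) : M * der (base M) :=
  (chart_param i z.1, @dirder R (base M) i z.1 z.2).

(* TM, and its open subset of nonzero vectors *)
Definition tbundle {R : realType} {n : nat} (M : manifold R n) : pspace R :=
  @PSpace R (M * der (base M))%type (chart M) ('rV[R]_n * 'rV[R]_n)%type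
    (fun i => [set z | (coord i @` chart_dom i) z.1]) (@TM_param R n M).

Definition slit {R : realType} {n : nat} (M : manifold R n) : pspace R :=
  @PSpace R (M * der (base M))%type (chart M) ('rV[R]_n * 'rV[R]_n)%type
    (fun i => [set z | (coord i @` chart_dom i) z.1 /\ z.2 != 0])
    (@TM_param R n M).

Section Finsler.
Context {R : realType} {n : nat} (M : manifold R n).

Local Notation TM := (M * der (base M))%type.
Local Notation vf := (vfield (slit M)).

(* sections of the pullback bundle, whose fibre at u is T_(pi u) M *)
Definition pifield := TM -> der (base M).

Definition smooth_pifield (X : pifield) : Prop :=
  forall u, points (P := slit M) u -> tangent (P := base M) u.1 (X u) /\
    forall g : base M -> R, smooth_at (P := base M) u.1 g ->
      smooth_at (P := slit M) u (fun w => X w g).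

Definition eta : pifield := fun u => u.2.

Definition gamma (u : TM) (w : der (base M)) : der (slit M) :=
  on_smooth (P := slit M) u
    (fun f => derive1 (fun t : R => f (u.1, u.2 + t *: w)) 0).

Definition rho (u : TM) (xi : der (slit M)) : der (base M) :=
  on_smooth (P := base M) u.1 (fun g => xi (g \o fst)).

Definition gammaf (X : pifield) : vf := fun u => gamma u (X u).
Definition rhof (X : vf) : pifield := fun u => rho u (X u).
Definition Jf (X : vf) : vf := gammaf (rhof X).
Definition liouville : vf := gammaf eta.

Definition d_J (f : TM -> R) (X : vf) (u : TM) : R := Jf X u f.

Definition pos_homogeneous1 (f : TM -> R) : Prop :=
  forall u, points (P := tbundle M) u ->
  forall c : R, 0 < c -> f (u.1, c *: u.2) = c * f u.

Definition energy (L : TM -> R) : TM -> R := fun u => 2^-1 * L u ^+ 2.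

(* the last field says that the 2-form dd_JE has maximal rank *)
Record finsler (L : TM -> R) : Prop := Finsler {
  finsler_continuous : forall i z, pdom (p := tbundle M) i z ->
    {for z, continuous (L \o param (p := tbundle M) i)};
  finsler_smooth : forall u, points (P := slit M) u ->
    smooth_at (P := slit M) u L;
  finsler_pos : forall u, points (P := slit M) u -> 0 < L u;
  finsler_homogeneous : pos_homogeneous1 L;
  finsler_nondegenerate : forall u, points (P := slit M) u ->
    forall X : vf, smooth_vfield X ->
    (forall Y : vf, smooth_vfield Y ->
       ext_d (d_J (energy L)) X Y u = 0) -> X u = 0
}.

Definition canonical_spray (L : TM -> R) (G : vf) : Prop :=
  smooth_vfield G /\
  forall X : vf, smooth_vfield X -> forall u, points (P := slit M) u ->
    ext_d (d_J (energy L)) G X u = - X u (energy L).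

Section Berwald.
Variable G : vf.

Definition barthel (X : vf) : vf := fun u =>
  bracket (Jf X) G u - Jf (bracket X G) u.

Definition hor (X : vf) : vf := fun u => 2^-1 *: (X u + barthel X u).
Definition ver (X : vf) : vf := fun u => 2^-1 *: (X u - barthel X u).

(* horizontal map; the image of h at u is {(h X)(u) | X a vector field} *)
Definition beta (u : TM) (w : der (base M)) : der (slit M) :=
  get [set xi | (exists2 X : vf, smooth_vfield X & xi = hor X u)
                /\ rho u xi = w].

Definition betaf (X : pifield) : vf := fun u => beta u (X u).

Definition Kf (X : vf) : pifield := fun u =>
  get [set w | tangent (P := base M) u.1 w /\ gamma u w = ver X u].

(* X = gamma (K X) + beta (rho X), so D_X Y is determined by its values for
   X = gamma Z and X = beta Z. *)
Definition berwald (X : vf) (Y : pifield) : pifield := fun u =>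
  rhof (bracket (gammaf (Kf X)) (betaf Y)) u
  + Kf (bracket (betaf (rhof X)) (gammaf Y)) u.

Definition curvature (X Y : vf) (Z : pifield) : pifield := fun u =>
  - berwald X (berwald Y Z) u + berwald Y (berwald X Z) u
  + berwald (bracket X Y) Z u.

Definition hcurv (X Y Z : pifield) : pifield :=
  curvature (betaf X) (betaf Y) Z.

Definition hcurv_hat (X Y : pifield) : pifield := hcurv X Y eta.

Definition chart_at (p : M) : chart M := projT1 (cid (chart_cover p)).

(* k-th coordinate field of the chart i, as a local pi-vector field *)
Definition frame (i : chart M) (k : 'I_n) : pifield := fun u =>
  @dirder R (base M) i (coord i u.1) (delta_mx ord0 k).

(* trace at u of a function-linear endomorphism A of pi-vector fields,
   computed in the coordinate frame of a chart at pi(u) *)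
Definition pitrace (A : pifield -> pifield) (u : TM) : R :=
  \sum_(k < n) A (frame (chart_at u.1) k) u
                 (fun p => coord (chart_at u.1) p ord0 k).

Definition R2 (X Y : pifield) : TM -> R :=
  pitrace (fun Z => hcurv X Z Y).

Definition R1 (X : pifield) : TM -> R := fun u =>
  (n%:R - 1)^-1 * (n%:R * R2 X eta u + R2 eta X u).

(* covariant derivative of a pi-form of degree 1 *)
Definition berwald_form (X : vf) (omega : pifield -> TM -> R) (Y : pifield)
    (u : TM) : R :=
  X u (omega Y) - omega (berwald X Y) u.

Definition weyl_torsion (X Y : pifield) : pifield := fun u =>
  let A (X Y : pifield) : der (base M) :=
    R1 Y u *: X u + berwald_form (gammaf X) R1 Y u *: eta u in
  hcurv_hat X Y u + (n%:R + 1)^-1 *: (A X Y - A Y X).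

Definition alpha (lambda : TM -> R) (X : pifield) : TM -> R :=
  d_J lambda (betaf X).

Definition Qform (lambda : TM -> R) (X : pifield) : TM -> R := fun u =>
  betaf X u lambda - lambda u * alpha lambda X u.

Definition hcurv_vanishes : Prop :=
  forall X Y Z : pifield,
    smooth_pifield X -> smooth_pifield Y -> smooth_pifield Z ->
  forall u, points (P := slit M) u -> hcurv X Y Z u = 0.

Definition weyl_torsion_vanishes : Prop :=
  forall X Y : pifield, smooth_pifield X -> smooth_pifield Y ->
  forall u, points (P := slit M) u -> weyl_torsion X Y u = 0.

End Berwald.

(* L -> L' is a projective change with projective factor lambda, where G and
   G' are the canonical sprays of L and L' *)
Record projective_change (L L' : TM -> R) (G G' : vf) (lambda : TM -> R)
    : Prop := ProjectiveChange {
  change_finsler : finsler L;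
  change_finsler' : finsler L';
  change_spray : canonical_spray L G;
  change_spray' : canonical_spray L' G';
  factor_smooth : forall u, points (P := slit M) u ->
    smooth_at (P := slit M) u lambda;
  factor_homogeneous : pos_homogeneous1 lambda;
  change_eq : forall u, points (P := slit M) u ->
    G' u = G u - (2 * lambda u) *: liouville u
}.

End Finsler.

(* Main.v *)
From HB Require Import structures.
From mathcomp Require Import all_boot all_order all_algebra.
From mathcomp Require Import all_classical all_reals all_analysis.
From mathcomp Require Import ring.
Require Import Defs.
Set Implicit Arguments.
Unset Strict Implicit.
Unset Printing Implicit Defensive.
Import Order.TTheory GRing.Theory Num.Theory numFieldNormedType.Exports.
Local Open Scope classical_set_scope.
Local Open Scope ring_scope.

(** Everything is computed in a chart of M, without indices: a chart identifies
the slit bundle with an open set of pairs z = (x, y) of row vectors, a vector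
field becomes a function z |-> (a, b), and a pi-vector field a function
z |-> a.

The nondegeneracy of dd_JE and the homogeneity of the energy show that the
canonical spray reads (y, - 2 g z) with g homogeneous of degree 2 in y
[spray_coefficients].  Writing N a for the derivative of g along the vertical
vector (0, a), and B a b for the derivative of N a along (0, b), which is
symmetric in a and b, the horizontal lift of a is (a, - N a) and the Berwald
connection is D_(xi) Y = dY(xi) + B (xi.1) Y [prep_berwald].  Its
h-curvature is then an explicit tensor [hcurv_chart], and two facts about it
carry the proof.  Contracting it with y gives the torsion
  H(a, b) = d(N a)(lift of b) - d(N b)(lift of a)      [curv_coef_hat],
and conversely the curvature is the vertical derivative of H [pd_curv_hat].
Hence the h-curvature vanishes if and only if H does.

The projective change replaces g by g + lambda y, and a direct computation
[curv_hat_projective] gives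
  H~(a, b) = H(a, b) + Q(b) a - Q(a) b + (d_a Q(b) - d_b Q(a)) y,
where d_a is the derivative along (0, a).  Once (n + 1) Q is substituted for
R_1, the Weyl torsion tensor W_2 is exactly the right-hand side, so that
W_2(X, Y) = H~(X, Y) for all X and Y [weyl_torsion_chart].  The form R_1
enters through its equality with (n + 1) Q on smooth pi-vector fields; the
derivative D_(gamma X) Y occurring in W_2 must therefore be shown to be smooth
[smooth_berwald_vertical].

The hypotheses and the definition of beta quantify over vector fields defined
on the whole slit bundle, while the computations prescribe values at one
point.  The two are linked by bump functions on M: every tangent vector is the
value of a global smooth field [smooth_vfield_through]. *)

(** * Directional derivatives of vector-valued maps *)
Section Differentiability.
Context {R : realType}.
Implicit Types U V W : normedModType R.

(** The difference of the two maps vanishes near x, hence is differentiable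
there with zero differential. *)
Lemma near_eq_differentiable V W (f g : V -> W) (x : V) :
  (\near x, f x = g x) -> differentiable f x -> differentiable g x.
Proof.
move=> fg df; pose h : V -> W := g - f.
have h0 : h x = 0 by rewrite /h !fctE -(nbhs_singleton fg) subrr.
suff dh : differentiable h x.
  have -> : g = f + h by rewrite /h addrC subrK.
  exact: differentiableD.
have key : h \o shift x = cst (h x) + (0 : V -> W) +o_ 0 id.
  apply/eqaddoP => _/posnumP[e]; rewrite h0.
  have : \forall y \near 0, f (y + x) = g (y + x).
    move: fg; rewrite (near_shift 0 x); apply: filterS => y.
    by rewrite /= subr0.
  apply: filterS => y /= E; rewrite !fctE /h /= !fctE E subrr addr0 subr0 normr0.
  by rewrite mulr_ge0.
apply/diff_locallyP.
have /= -> := @diff_unique _ _ _ h (\0 : {linear V -> W}) x _ key.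
  by split => //; exact: cst_continuous.
exact: cst_continuous.
Unshelve. all: by end_near. Qed.

Lemma eq_on_near V W (D : set V) (f g : V -> W) x :
  open D -> (forall y, D y -> f y = g y) -> D x -> \near x, f x = g x.
Proof. by move=> oD fg Dx; apply: filterS fg _; exact: open_nbhs_nbhs. Qed.

Lemma derive_is_linear V W (f : V -> W) x : differentiable f x ->
  linear (fun v => 'D_v f x).
Proof. by move=> df a u v; rewrite !deriveE// linearP. Qed.

Lemma derive_is_diff V W (f df : V -> W) x v :
  is_diff x f df -> 'D_v f x = df v.
Proof. by move=> h; rewrite deriveE // diff_val. Qed.

Lemma derive_addf V W (f g : V -> W) x v :
  differentiable f x -> differentiable g x ->
  'D_v (fun z => f z + g z) x = 'D_v f x + 'D_v g x.
Proof.
by move=> df dg; apply: (@deriveD _ _ _ f g); exact: diff_derivable.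
Qed.

Lemma derive_subf V W (f g : V -> W) x v :
  differentiable f x -> differentiable g x ->
  'D_v (fun z => f z - g z) x = 'D_v f x - 'D_v g x.
Proof.
by move=> df dg; apply: (@deriveB _ _ _ f g); exact: diff_derivable.
Qed.

Lemma derive_linear_map V W (l : {linear V -> W}) x v :
  continuous l -> 'D_v l x = l v.
Proof.
by move=> cl; rewrite deriveE; [rewrite diff_lin|exact: linear_differentiable].
Qed.

Lemma derive_comp U V W (f : U -> V) (g : V -> W) x v :
  differentiable f x -> differentiable g (f x) ->
  'D_v (fun z => g (f z)) x = 'D_('D_v f x) g (f x).
Proof.
move=> df dg; rewrite !deriveE //; last exact: (differentiable_comp (g := g)).
by rewrite (diff_comp (g := g)).
Qed.

Lemma derive_pair U V W (f : U -> V) (g : U -> W) x v :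
  differentiable f x -> differentiable g x ->
  'D_v (fun z => (f z, g z)) x = ('D_v f x, 'D_v g x).
Proof.
move=> df dg; rewrite !deriveE //; last exact: differentiable_pair.
by rewrite diff_pair.
Qed.

End Differentiability.

Section ScaleBilinear.
Context {R : realType} (W : normedModType R).
(** A name for the scaling operation, so that it can carry the bilinear
structure from which the product rule follows. *)
Definition scaling (a : R) (w : W) : W := a *: w.

Lemma scale_is_bilinear :
  bilinear_for
    (GRing.Scale.Law.clone _ _ *:%R _) (GRing.Scale.Law.clone _ _ *:%R _)
    scaling.
Proof.
rewrite /scaling; split=> [u'|u] a x y /=.
- by rewrite scalerDl scalerA.
- by rewrite scalerDr !scalerA mulrC.
Qed.
HB.instance Definition _ := bilinear_isBilinear.Build R R W W _ _
  scaling scale_is_bilinear.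

Lemma is_diff_scale (V : normedModType R) (k : V -> R) (f : V -> W) x :
  differentiable k x -> differentiable f x ->
  is_diff x (fun z => k z *: f z)
    (fun v => k x *: 'd f x v + 'd k x v *: f x).
Proof.
move=> dk df.
pose B : {bilinear R -> W -> W} := scaling.
have cB : continuous (fun p => B p.1 p.2) by move=> p; exact: scale_continuous.
have dp := differentiable_pair dk df.
have dB := differentiable_bilin (k x, f x) cB.
split; first exact: (@differentiable_comp _ _ _ _ _ _ x dp dB).
rewrite (@diff_comp _ _ _ _ _ _ x dp dB) diff_pair //=.
by have /= -> := diff_bilin (k x, f x) cB.
Qed.

Lemma derive_scale (V : normedModType R) (k : V -> R) (f : V -> W) x v :
  differentiable k x -> differentiable f x ->
  'D_v (fun z => k z *: f z) x = k x *: 'D_v f x + 'D_v k x *: f x.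
Proof.
by move=> dk df; have h := is_diff_scale dk df; rewrite derive_is_diff !deriveE.
Qed.
End ScaleBilinear.

(** * Smooth maps on an open set *)

(** A basis together with its continuous coordinate forms.  Expanding vectors
on it turns derivatives along a variable direction into finite sums of
products. *)
Class findim (R : realType) (V : normedModType R) := Findim {
  basis_index : finType;
  basis_vec : basis_index -> V;
  basis_coord : basis_index -> {linear V -> R};
  basis_coord_continuous : forall j, continuous (basis_coord j);
  basis_expand : forall v : V, v = \sum_(j : basis_index) basis_coord j v *: basis_vec j
}.
Arguments basis_index {R} V {_}.
Arguments basis_coord_continuous {R V _} j.

Section Ckv.
Context {R : realType}.
Implicit Types U V W : normedModType R.

(** The same recursion as for real-valued functions, with values in a normed
space, so that vector fields are differentiated without coordinates. *)
Fixpoint Ckv V W (k : nat) (D : set V) (f : V -> W) : Prop :=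
  match k with
  | 0 => forall x, D x -> {for x, continuous f}
  | k'.+1 => (forall x, D x -> differentiable f x)
             /\ forall v : V, Ckv k' D ('D_v f)
  end.

Definition smoothOn V W (D : set V) (f : V -> W) := forall k, Ckv k D f.

Lemma Ck_Ckv V k (D : set V) (f : V -> R) : Ck k D f <-> Ckv k D f.
Proof.
elim: k f => [|k IH] f //=; split=> -[df Df]; split=> // v; exact/IH.
Qed.

Lemma Ckv_eq V W k (D : set V) (f g : V -> W) : open D ->
  (forall x, D x -> f x = g x) -> Ckv k D f -> Ckv k D g.
Proof.
move=> oD; elim: k f g => [|k IH] f g fg /=.
  move=> cf x Dx; have nfg := eq_on_near oD fg Dx.
  have : f @ x --> f x := cf x Dx; rewrite fg// => h.
  change (g @ x --> g x); apply: cvg_trans h; exact: near_eq_cvg.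
case=> df Df; split=> [x Dx|v].
  by apply: near_eq_differentiable (df x Dx); exact: eq_on_near oD fg Dx.
apply: IH (Df v) => x Dx; apply: near_eq_derive; exact: eq_on_near oD fg Dx.
Qed.

Lemma Ckv_pred V W k (D : set V) (f : V -> W) : Ckv k.+1 D f -> Ckv k D f.
Proof.
elim: k f => [|k IH] f [df Df].
  by move=> x Dx; apply: differentiable_continuous; exact: df.
by split=> // v; exact: IH.
Qed.

Lemma Ckv_subset V W k (D D' : set V) (f : V -> W) : D' `<=` D ->
  Ckv k D f -> Ckv k D' f.
Proof.
move=> DD; elim: k f => [|k IH] f /=; first by move=> cf x /DD; exact: cf.
by move=> [df Df]; split=> [x /DD|v]; [exact: df|exact: IH].
Qed.

Lemma Ckv_local V W k (D : set V) (f : V -> W) :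
  (forall x, D x -> exists O : set V, [/\ open O, O x & Ckv k O f]) -> Ckv k D f.
Proof.
elim: k f => [|k IH] f h /=; first by move=> x /h [U [_ Ux]]; exact.
split=> [x /h [U [_ Ux [df _]]]|v]; first exact: df.
by apply: IH => x /h [U [oU Ux [_ Df]]]; exists U; split=> //; exact: Df.
Qed.

Lemma smooth_nearP V x (f : V -> R) :
  smooth_near x f <-> exists O : set V, [/\ open O, O x & smoothOn O f].
Proof.
by split=> -[U [oU Ux h]]; exists U; split=> // k; exact/Ck_Ckv.
Qed.

Lemma smoothOn_local V W (D : set V) (f : V -> W) :
  (forall x, D x -> exists O : set V, [/\ open O, O x & smoothOn O f]) -> smoothOn D f.
Proof.
by move=> h k; apply: Ckv_local => x /h [U [oU Ux sf]]; exists U; split=> //; exact: sf.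
Qed.

Lemma smoothOn_eq V W (D : set V) (f g : V -> W) : open D ->
  (forall x, D x -> f x = g x) -> smoothOn D f -> smoothOn D g.
Proof. by move=> oD fg sf k; exact: Ckv_eq fg (sf k). Qed.

Lemma smoothOn_subset V W (D D' : set V) (f : V -> W) : D' `<=` D ->
  smoothOn D f -> smoothOn D' f.
Proof. by move=> DD sf k; exact: Ckv_subset (sf k). Qed.

Lemma smoothOn_differentiable V W (D : set V) (f : V -> W) x :
  smoothOn D f -> D x -> differentiable f x.
Proof. by move=> /(_ 1%N) [df _]; exact: df. Qed.

Lemma smoothOn_derive V W (D : set V) (f : V -> W) v :
  smoothOn D f -> smoothOn D ('D_v f).
Proof. by move=> sf k; have [_] := sf k.+1; exact. Qed.

Lemma Ckv_cst V W k (D : set V) (c : W) : Ckv k D (fun=> c).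
Proof.
elim: k c => [|k IH] c /=; first by move=> x _; exact: cst_continuous.
split=> [x _|v]; first exact: differentiable_cst.
rewrite (_ : 'D_v _ = fun=> 0); first exact: IH.
by apply: funext => x; exact: (derive_cst c).
Qed.

Lemma smoothOn_cst V W (D : set V) (c : W) : smoothOn D (fun=> c).
Proof. by move=> k; exact: Ckv_cst. Qed.

Lemma Ckv_add V W k (D : set V) (f g : V -> W) : open D ->
  Ckv k D f -> Ckv k D g -> Ckv k D (fun z => f z + g z).
Proof.
move=> oD; elim: k f g => [|k IH] f g /=.
  by move=> cf cg x Dx; apply: continuousD; [exact: cf|exact: cg].
move=> [df Df] [dg Dg]; split=> [x Dx|v].
  by apply: (differentiableD (f := f) (g := g)); [exact: df|exact: dg].
apply: Ckv_eq (IH _ _ (Df v) (Dg v)) => // x Dx.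
by rewrite derive_addf//; [exact: df|exact: dg].
Qed.

Lemma Ckv_scale V W k (D : set V) (f : V -> R) (g : V -> W) : open D ->
  Ckv k D f -> Ckv k D g -> Ckv k D (fun z => f z *: g z).
Proof.
move=> oD; elim: k f g => [|k IH] f g.
  by move=> /= cf cg x Dx; apply: continuousZ; [exact: cf|exact: cg].
move=> sf sg; have := sf; have := sg => -[dg Dg] [df Df]; split=> [x Dx|v].
  by have [] := is_diff_scale (df x Dx) (dg x Dx).
have h := Ckv_add oD (IH _ _ (Ckv_pred sf) (Dg v)) (IH _ _ (Df v) (Ckv_pred sg)).
by apply: Ckv_eq h => // x Dx; rewrite derive_scale//; [exact: df|exact: dg].
Qed.

Lemma smoothOn_add V W (D : set V) (f g : V -> W) : open D ->
  smoothOn D f -> smoothOn D g -> smoothOn D (fun z => f z + g z).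
Proof. by move=> oD sf sg k; exact: Ckv_add. Qed.

Lemma smoothOn_scale V W (D : set V) (f : V -> R) (g : V -> W) : open D ->
  smoothOn D f -> smoothOn D g -> smoothOn D (fun z => f z *: g z).
Proof. by move=> oD sf sg k; exact: Ckv_scale. Qed.

Lemma smoothOn_opp V W (D : set V) (f : V -> W) : open D ->
  smoothOn D f -> smoothOn D (fun z => - f z).
Proof.
move=> oD sf; apply: (smoothOn_eq (f := fun z => (-1) *: f z)) => //.
  by move=> x _; rewrite scaleN1r.
by apply: smoothOn_scale => //; exact: smoothOn_cst.
Qed.

Lemma smoothOn_minus V W (D : set V) (f g : V -> W) : open D ->
  smoothOn D f -> smoothOn D g -> smoothOn D (fun z => f z - g z).
Proof. by move=> oD sf sg; apply: smoothOn_add => //; exact: smoothOn_opp. Qed.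

Lemma Ckv_sum V W k (D : set V) (I : Type) (r : seq I) (F : I -> V -> W) :
  open D -> (forall j, Ckv k D (F j)) ->
  Ckv k D (fun z => \sum_(j <- r) F j z).
Proof.
move=> oD sF; elim: r => [|j r IH].
  by apply: Ckv_eq (Ckv_cst k D 0) => // x _; rewrite big_nil.
by apply: Ckv_eq (Ckv_add oD (sF j) IH) => // x _; rewrite big_cons.
Qed.

Lemma differentiable_sumf V W (I : Type) (r : seq I) (F : I -> V -> W) x :
  (forall j, differentiable (F j) x) ->
  differentiable (fun z => \sum_(j <- r) F j z) x.
Proof.
move=> dF; elim: r => [|j r IH].
  rewrite (_ : (fun _ => _) = cst 0); first exact: differentiable_cst.
  by apply: funext => z; rewrite big_nil.
rewrite (_ : (fun _ => _) = F j + (fun z => \sum_(j <- r) F j z)).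
  exact: differentiableD.
by apply: funext => z; rewrite big_cons.
Qed.

Lemma derive_sumf V W (I : Type) (r : seq I) (F : I -> V -> W) x v :
  (forall j, differentiable (F j) x) ->
  'D_v (fun z => \sum_(j <- r) F j z) x = \sum_(j <- r) 'D_v (F j) x.
Proof.
move=> dF; elim: r => [|j r IH].
  rewrite (_ : (fun _ => _) = cst 0) ?big_nil ?derive_cst//.
  by apply: funext => z; rewrite big_nil.
rewrite big_cons -IH -derive_addf//; last exact: differentiable_sumf.
by congr ('D_v _ x); apply: funext => z; rewrite big_cons.
Qed.

Lemma Ckv_linear_comp U V W k (D : set U) (l : {linear V -> W}) (f : U -> V) :
  open D -> continuous l -> Ckv k D f -> Ckv k D (fun z => l (f z)).
Proof.
move=> oD cl; elim: k f => [|k IH] f /=.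
  by move=> cf x Dx; apply: continuous_comp; [exact: cf|exact: cl].
move=> [df Df]; have dl y : differentiable l y by exact: linear_differentiable.
split=> [x Dx|v]; first by apply: (differentiable_comp (g := l)) => //; exact: df.
apply: Ckv_eq (IH _ (Df v)) => // x Dx.
by rewrite (derive_comp (g := l))// ?derive_linear_map//; exact: df.
Qed.

Lemma smoothOn_linear_comp U V W (D : set U) (l : {linear V -> W}) (f : U -> V) :
  open D -> continuous l -> smoothOn D f -> smoothOn D (fun z => l (f z)).
Proof. by move=> oD cl sf k; exact: Ckv_linear_comp. Qed.

Lemma smoothOn_id V (D : set V) : smoothOn D id.
Proof.
case=> [|k] /=; first by move=> x _; exact: cvg_id.
split=> [x _|v]; first exact: ex_diff.
rewrite (_ : 'D_v _ = fun=> v); first exact: Ckv_cst.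
by apply: funext => x; exact: derive_id.
Qed.

Lemma smoothOn_linear_map V W (D : set V) (l : {linear V -> W}) :
  open D -> continuous l -> smoothOn D l.
Proof. by move=> oD cl; apply: smoothOn_linear_comp => //; exact: smoothOn_id. Qed.

Lemma smoothOn_pair U V W (D : set U) (f : U -> V) (g : U -> W) :
  open D -> smoothOn D f -> smoothOn D g -> smoothOn D (fun z => (f z, g z)).
Proof.
move=> oD + + k; elim: k f g => [|k IH] f g /= sf sg.
  move=> x Dx; have cf := sf 0%N x Dx; have cg := sg 0%N x Dx.
  exact: cvg_pair.
split=> [x Dx|v].
  by apply: differentiable_pair; 
    [exact: smoothOn_differentiable sf Dx|exact: smoothOn_differentiable sg Dx].
apply: Ckv_eq (IH _ _ (smoothOn_derive v sf) (smoothOn_derive v sg)) => // x Dx.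
by rewrite derive_pair//; 
    [exact: smoothOn_differentiable sf Dx|exact: smoothOn_differentiable sg Dx].
Qed.

End Ckv.

Section FiniteDim.
Context {R : realType}.
Implicit Types U V W : normedModType R.

Lemma linear_expand V W {fV : findim V} (h : V -> W) v : linear h ->
  h v = \sum_(j : basis_index V) basis_coord j v *: h (basis_vec j).
Proof.
move=> lh; pose hM := GRing.isLinear.Build _ _ _ _ _ lh.
pose hL : {linear _ -> _} := HB.pack h hM.
rewrite {1}(basis_expand v) -[h]/(hL : _ -> _) linear_sum; apply: eq_bigr => j _.
by rewrite linearZ.
Qed.

Lemma Ckv_comp U V W {fV : findim V} k (D : set U) (D' : set V)
  (T : U -> V) (f : V -> W) : open D ->
  smoothOn D T -> (forall z, D z -> D' (T z)) ->
  Ckv k D' f -> Ckv k D (fun z => f (T z)).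
Proof.
move=> oD sT TD; elim: k f => [|k IH] f /=.
  move=> cf x Dx; apply: (continuous_comp (g := f)) (sT 0%N x Dx) _.
  exact: cf (TD _ Dx).
move=> [df Df]; split=> [x Dx|v].
  by apply: (differentiable_comp (g := f)); 
    [exact: smoothOn_differentiable sT Dx|exact: df _ (TD _ Dx)].
pose F (j : @basis_index _ _ fV) z := basis_coord j ('D_v T z) *: 'D_(basis_vec j) f (T z).
apply: (Ckv_eq (f := fun z => \sum_(j : basis_index V) F j z)) => // [x Dx|].
  rewrite derive_comp; [|exact: smoothOn_differentiable sT Dx|exact: df _ (TD _ Dx)].
  have lf := derive_is_linear (df _ (TD _ Dx)).
  by rewrite (linear_expand ('D_v T x) lf).
apply: Ckv_sum => // j; apply: Ckv_scale => //; last exact: (IH ('D_(basis_vec j) f) (Df _)).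
apply: Ckv_linear_comp => //; first exact: basis_coord_continuous.
exact: smoothOn_derive v sT k.
Qed.

Lemma smoothOn_comp U V W {fV : findim V} (D : set U) (D' : set V)
  (T : U -> V) (f : V -> W) : open D ->
  smoothOn D T -> (forall z, D z -> D' (T z)) ->
  smoothOn D' f -> smoothOn D (fun z => f (T z)).
Proof. by move=> oD sT TD sf k; exact: Ckv_comp (sf k). Qed.

Lemma smoothOn_coords V W {fW : findim W} (D : set V) (f : V -> W) : open D ->
  (forall j : basis_index W, smoothOn D (fun z => basis_coord j (f z))) -> smoothOn D f.
Proof.
move=> oD sf k; apply: (Ckv_eq (f := fun z => \sum_j basis_coord j (f z) *: basis_vec j)) => //.
  by move=> x _; rewrite -basis_expand.
apply: Ckv_sum => // j; apply: Ckv_scale => //; [exact: sf|exact: Ckv_cst].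
Qed.

(** Spray coefficients, connection coefficients and differentials are all
families of linear maps v |-> F z v evaluated at a vector c z that moves with
z.  Expanding c z on a basis reduces them to sums of products, which gives
both smoothness and, below, the Leibniz rule. *)
Lemma smoothOn_family U V W {fV : findim V} (D : set U) (F : U -> V -> W)
  (c : U -> V) : open D -> (forall z, D z -> linear (F z)) ->
  (forall v, smoothOn D (F ^~ v)) -> smoothOn D c ->
  smoothOn D (fun z => F z (c z)).
Proof.
move=> oD lF sF sc k.
apply: (Ckv_eq (f := fun z => \sum_j basis_coord j (c z) *: F z (basis_vec j))) => //.
  by move=> x Dx; rewrite -linear_expand//; exact: lF.
apply: Ckv_sum => // j; apply: Ckv_scale => //; last exact: sF.
by apply: Ckv_linear_comp => //; exact: basis_coord_continuous.
Qed.

Lemma derive_family U V W {fV : findim V} (D : set U) (F : U -> V -> W)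
  (c : U -> V) x w : open D -> D x -> (forall z, D z -> linear (F z)) ->
  (forall v, differentiable (F ^~ v) x) -> differentiable c x ->
  'D_w (fun z => F z (c z)) x = 'D_w (F ^~ (c x)) x + F x ('D_w c x).
Proof.
move=> oD Dx lF dF dc.
have dl j : differentiable (fun z => basis_coord j (c z)) x.
  apply: (differentiable_comp (g := basis_coord j)) => //.
  by apply: linear_differentiable; exact: basis_coord_continuous.
have E (h : U -> V) : \near x,
    F x (h x) = \sum_j basis_coord j (h x) *: F x (basis_vec j).
  by apply: eq_on_near oD _ Dx => z Dz; rewrite -linear_expand//; exact: lF.
rewrite (near_eq_derive _ (E c)) (near_eq_derive _ (E (fun=> c x))).
have ds (k : @basis_index _ _ fV -> U -> R) j : differentiable (k j) x ->
    differentiable (fun z => k j z *: F z (basis_vec j)) x.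
  by move=> dk; have [] := is_diff_scale dk (dF (basis_vec j)).
rewrite !derive_sumf; first last.
- by move=> j; apply: (ds (fun j z => basis_coord j (c z))); exact: dl.
- move=> j; apply: (ds (fun j _ => basis_coord j (c x))).
  exact: differentiable_cst.
rewrite (linear_expand ('D_w c x) (lF _ Dx)) -big_split/=; apply: eq_bigr => j _.
have dk (a : R) : differentiable (fun _ : U => a) x by exact: differentiable_cst.
rewrite !derive_scale//.
rewrite (derive_cst (basis_coord j (c x))) scale0r addr0; congr (_ + _ *: _).
rewrite (derive_comp (g := basis_coord j))//; first last.
  by apply: linear_differentiable; exact: basis_coord_continuous.
by rewrite derive_linear_map//; exact: basis_coord_continuous.
Qed.

Lemma smoothOn_derive_field V W {fV : findim V} (D : set V) (f : V -> W)
  (c : V -> V) : open D -> smoothOn D f -> smoothOn D c ->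
  smoothOn D (fun z => 'D_(c z) f z).
Proof.
move=> oD sf sc; apply: (smoothOn_family (F := fun z v => 'D_v f z)) => //.
  by move=> z Dz; apply: derive_is_linear; exact: smoothOn_differentiable sf Dz.
by move=> v; exact: smoothOn_derive.
Qed.

End FiniteDim.

(** * Symmetry of second derivatives *)
Section Schwarz.
Context {R : realType}.
Implicit Types V W : normedModType R.

Lemma differentiable_translate V (c x : V) : differentiable (fun z => z + c) x.
Proof.
by apply: (differentiableD (f := id) (g := cst c)); [exact: ex_diff|exact: differentiable_cst].
Qed.

Lemma derive_translate V W (f : V -> W) (c x v : V) : differentiable f (x + c) ->
  'D_v (fun z => f (z + c)) x = 'D_v f (x + c).
Proof.
move=> df; have dt := differentiable_translate c x.
rewrite (derive_comp (f := fun z => z + c))//.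
have dc : differentiable (fun _ : V => c) x by exact: differentiable_cst.
have di : differentiable (@id V) x by exact: ex_diff.
by rewrite (derive_addf (f := id))// derive_id (derive_cst c) addr0.
Qed.

Lemma differentiable_line V (x v : V) (s : R) :
  differentiable (fun t : R => t *: v + x) s.
Proof.
by apply: (differentiableD (f := fun t : R => t *: v) (g := cst x));
  [exact: ex_diff|exact: differentiable_cst].
Qed.

Lemma derive_line V (x v : V) (s : R) : 'D_1 (fun t : R => t *: v + x) s = v.
Proof.
have dx : differentiable (fun _ : R => x) s by exact: differentiable_cst.
have dv : differentiable (fun t : R => t *: v) s by exact: ex_diff.
by rewrite (derive_addf (f := fun t : R => t *: v))// derive_is_diff (derive_cst x) scale1r addr0.
Qed.

Lemma mvt_direction V (f : V -> R) (x v : V) (d : R) : 0 < d ->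
  (forall s, 0 <= s <= d -> differentiable f (s *: v + x)) ->
  exists2 s, 0 < s < d & f (d *: v + x) - f x = 'D_v f (s *: v + x) * d.
Proof.
move=> d0 df; pose g (s : R) := f (s *: v + x).
have dg s : 0 <= s <= d -> differentiable g s.
  move=> sd; apply: (differentiable_comp (f := fun t : R => t *: v + x) (g := f)).
    exact: differentiable_line.
  exact: df.
have [|s|s] := @MVT R g (fun s => 'D_v f (s *: v + x)) 0 d d0.
- move=> s; rewrite in_itv/= => /andP[s0 sd].
  have sd' : 0 <= s <= d by rewrite !ltW.
  split; first exact: diff_derivable (dg _ sd').
  have dl := differentiable_line x v s; have dfs := df _ sd'.
  by rewrite (derive_comp (f := fun t : R => t *: v + x))// derive_line.
- apply: derivable_within_continuous => t; rewrite in_itv/= => td.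
  exact: diff_derivable (dg _ td).
by rewrite in_itv/= subr0 /g scale0r add0r => sd E; exists s.
Qed.

(** The mean value theorem, first along v for the increment of f along w,
then along w for the derivative of f along v. *)
Lemma second_difference V (f : V -> R) (D : set V) (x v w : V) (d : R) :
  0 < d -> smoothOn D f ->
  (forall s t, 0 <= s <= d -> 0 <= t <= d -> D (s *: v + (t *: w + x))) ->
  exists s t, [/\ 0 < s < d, 0 < t < d &
    f (d *: v + (d *: w + x)) - f (d *: w + x) - (f (d *: v + x) - f x)
    = 'D_w ('D_v f) (s *: v + (t *: w + x)) * d * d].
Proof.
move=> d0 sf inD; pose g y := f (y + d *: w) - f y.
have d00 : 0 <= (0 : R) <= d by rewrite lexx ltW.
have dd : 0 <= d <= d by rewrite lexx ltW.
have D1 s : 0 <= s <= d -> D (s *: v + x + d *: w).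
  by move=> sd; rewrite -addrA [x + _]addrC; exact: inD.
have D0 s : 0 <= s <= d -> D (s *: v + x).
  by move=> sd; rewrite -(add0r x) -(scale0r w); exact: inD.
have df1 s : 0 <= s <= d -> differentiable (fun y => f (y + d *: w)) (s *: v + x).
  move=> sd; apply: (differentiable_comp (g := f)).
    exact: differentiable_translate.
  exact: smoothOn_differentiable sf (D1 _ sd).
have df0 s : 0 <= s <= d -> differentiable f (s *: v + x).
  by move=> sd; exact: smoothOn_differentiable sf (D0 _ sd).
have [|s sd E] := @mvt_direction V g x v d d0.
  move=> s sd; apply: (differentiableB (f := fun y => f (y + d *: w))).
  - exact: df1.
  - exact: df0.
have sd' : 0 <= s <= d by case/andP: sd => ? ?; rewrite !ltW.
have [|t td E'] := @mvt_direction V ('D_v f) (s *: v + x) w d d0.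
  move=> t td; apply: smoothOn_differentiable (smoothOn_derive v sf) _.
  by rewrite addrCA; exact: inD.
exists s, t; split=> //; rewrite [s *: v + (t *: w + x)]addrCA -E'.
move: E; rewrite /g derive_subf; [|exact: df1|exact: df0].
rewrite derive_translate; last exact: smoothOn_differentiable sf (D1 _ sd').
rewrite [x + d *: w]addrC -[d *: v + x + _]addrA [x + d *: w]addrC.
rewrite [s *: v + x + _]addrC => <-.
by rewrite !opprB addrACA [RHS]addrACA [- _ + _]addrC.
Qed.

(** The points s v + t w + x stay within d (|v| + |w|) of x. *)
Lemma near_square V (P : V -> Prop) (x v w : V) : (\forall y \near x, P y) ->
  exists2 d : R, 0 < d & forall s t, 0 <= s <= d -> 0 <= t <= d ->
    P (s *: v + (t *: w + x)).
Proof.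
move=> /nbhs_normP [e /= e0 eP].
pose m := `|v| + `|w| + 1.
have m0 : 0 < m by rewrite ltr_wpDl// addr_ge0.
exists (e / 2 / m); first by rewrite !divr_gt0.
move=> s t /andP[s0 sd] /andP[t0 td]; apply: eP => /=.
rewrite /ball_/= addrA opprD addrCA subrr addr0 normrN.
rewrite (le_lt_trans (ler_normD _ _))// !normrZ !ger0_norm//.
apply: (@le_lt_trans _ _ (e / 2 / m * (`|v| + `|w|))).
  by rewrite mulrDr lerD// ler_wpM2r.
rewrite (@le_lt_trans _ _ (e / 2))//; last by rewrite ltr_pdivrMr// ltr_pMr// ltr1n.
rewrite -mulrA ger_pMr ?divr_gt0// ler_pdivrMl// mulr1.
by rewrite /m lerDl.
Qed.

Lemma eq_of_common_approx (a b : R) :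
  (forall e : R, 0 < e -> exists c, `|a - c| < e /\ `|b - c| < e) -> a = b.
Proof.
move=> H; apply/eqP; rewrite -subr_eq0 -normr_le0; apply/ler_addgt0Pr => e e0.
have [|c [ac bc]] := H (e / 2); first by rewrite divr_gt0.
rewrite add0r -(subrKA c) (le_trans (ler_normD _ _))// (splitr e).
by rewrite lerD// ltW// distrC.
Qed.

(** If q d / d^2 is a value of A and also a value of B at points that tend to
x with d, continuity forces A x = B x. *)
Lemma eq_of_common_quotient V (A B : V -> R) (q : R -> R) (D : set V)
    (x v w : V) :
  (\forall y \near x, D y) -> A @ x --> A x -> B @ x --> B x ->
  (forall d, 0 < d -> (forall s t, 0 <= s <= d -> 0 <= t <= d ->
       D (s *: v + (t *: w + x))) ->
     exists s t, [/\ 0 < s < d, 0 < t < d &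
       q d = A (s *: v + (t *: w + x)) * d * d]) ->
  (forall d, 0 < d -> (forall s t, 0 <= s <= d -> 0 <= t <= d ->
       D (s *: w + (t *: v + x))) ->
     exists s t, [/\ 0 < s < d, 0 < t < d &
       q d = B (s *: w + (t *: v + x)) * d * d]) ->
  A x = B x.
Proof.
move=> nD c1 c2 EA EB; apply: eq_of_common_approx => e e0.
have nA : \forall y \near x, `|A x - A y| < e by exact: cvgr_dist_lt c1 _ e0.
have nB : \forall y \near x, `|B x - B y| < e by exact: cvgr_dist_lt c2 _ e0.
have [d d0 H] := @near_square V _ x v w (filterI nD (filterI nA nB)).
have [s [t [/andP[s0 sd] /andP[t0 td] E1]]] := EA _ d0
   (fun s t hs ht => (H s t hs ht).1).
have [|t' [s' [/andP[t'0 t'd] /andP[s'0 s'd] E2]]] := EB _ d0.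
  by move=> s1 t1 h1 h2; rewrite addrCA; exact: (H _ _ h2 h1).1.
have E : A (s *: v + (t *: w + x)) = B (s' *: v + (t' *: w + x)).
  have dN : d != 0 by rewrite gt_eqF.
  move: E1; rewrite E2 [s' *: v + (t' *: w + x)]addrCA.
  by move=> /(mulIf dN)/(mulIf dN).
have [_ [h1 _]] := H s t (introT andP (conj (ltW s0) (ltW sd)))
   (introT andP (conj (ltW t0) (ltW td))).
have [_ [_ h2]] := H s' t' (introT andP (conj (ltW s'0) (ltW s'd)))
   (introT andP (conj (ltW t'0) (ltW t'd))).
by exists (B (s' *: v + (t' *: w + x))); split=> //; rewrite -E.
Qed.

(** The second difference of f over a parallelogram is unchanged when its two
sides are exchanged. *)
Lemma schwarz_scalar V (f : V -> R) (D : set V) (x v w : V) :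
  open D -> D x -> smoothOn D f -> 'D_w ('D_v f) x = 'D_v ('D_w f) x.
Proof.
move=> oD Dx sf.
pose q d := f (d *: v + (d *: w + x)) - f (d *: w + x) - (f (d *: v + x) - f x).
apply: (@eq_of_common_quotient V ('D_w ('D_v f)) ('D_v ('D_w f)) q D x v w).
- exact: open_nbhs_nbhs.
- exact: (smoothOn_derive w (smoothOn_derive v sf) 0%N x Dx).
- exact: (smoothOn_derive v (smoothOn_derive w sf) 0%N x Dx).
- by move=> d d0 H; exact: second_difference d0 sf H.
- move=> d d0 H; have [s [t [hs ht E]]] := second_difference d0 sf H.
  exists s, t; split=> //; rewrite -E /q [d *: w + (d *: v + x)]addrCA.
  by rewrite !opprB addrACA [RHS]addrACA [- _ - f (d *: v + x)]addrC.
Qed.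

Lemma schwarz V W {fW : findim W} (f : V -> W) (D : set V) (x v w : V) :
  open D -> D x -> smoothOn D f -> 'D_w ('D_v f) x = 'D_v ('D_w f) x.
Proof.
move=> oD Dx sf.
have cj (j : @basis_index _ _ fW) := basis_coord_continuous j.
suff H (j : @basis_index _ _ fW) :
    basis_coord j ('D_w ('D_v f) x) = basis_coord j ('D_v ('D_w f) x).
  rewrite (basis_expand ('D_w ('D_v f) x)) (basis_expand ('D_v ('D_w f) x)).
  by apply: eq_bigr => j _; rewrite H.
have E v1 y : D y -> basis_coord j ('D_v1 f y) = 'D_v1 (fun z => basis_coord j (f z)) y.
  move=> Dy; rewrite (derive_comp (g := basis_coord j)).
  - by rewrite derive_linear_map.
  - exact: smoothOn_differentiable sf Dy.
  - exact: linear_differentiable.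
have E2 v1 v2 : basis_coord j ('D_v1 ('D_v2 f) x) =
    'D_v1 ('D_v2 (fun z => basis_coord j (f z))) x.
  have -> : basis_coord j ('D_v1 ('D_v2 f) x) = 'D_v1 (fun z => basis_coord j ('D_v2 f z)) x.
    rewrite (derive_comp (g := basis_coord j)).
    - by rewrite derive_linear_map.
    - exact: smoothOn_differentiable (smoothOn_derive _ sf) Dx.
    - exact: linear_differentiable.
  by apply: near_eq_derive; apply: eq_on_near oD _ Dx => y; exact: E.
by rewrite !E2; apply: (schwarz_scalar _ _ oD Dx); exact: smoothOn_linear_comp.
Qed.

End Schwarz.

Section FindimInstances.
Context {R : realType}.

Definition rVcoord n (k : 'I_n) (x : 'rV[R]_n) : R := x ord0 k.
Lemma rVcoord_linear n (k : 'I_n) : linear (@rVcoord n k).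
Proof. by move=> a u v; rewrite /rVcoord !mxE. Qed.
HB.instance Definition _ n k :=
  GRing.isLinear.Build _ _ _ _ (@rVcoord n k) (@rVcoord_linear n k).

Lemma rVcoord_continuous n (k : 'I_n) : continuous (@rVcoord n k).
Proof. exact: (@matrix_normedtype.coord_continuous R 1 n ord0 k). Qed.

#[global] Program Instance findim_rV n : findim 'rV[R]_n := {|
  basis_index := 'I_n; basis_vec := fun k => delta_mx ord0 k;
  basis_coord := fun k => @rVcoord n k : {linear _ -> _};
  basis_coord_continuous := @rVcoord_continuous n
|}.
Next Obligation. by move=> n v; rewrite {1}(row_sum_delta v). Qed.

Section Prod.
Variables (V W : normedModType R).

Lemma prod_fst_continuous : continuous (fst : V * W -> V).
Proof. by move=> x; exact: cvg_fst. Qed.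
Lemma prod_snd_continuous : continuous (snd : V * W -> W).
Proof. by move=> x; exact: cvg_snd. Qed.

Context {fV : findim V} {fW : findim W}.

Definition prod_coord (j : basis_index V + basis_index W) (z : V * W) : R :=
  match j with inl k => basis_coord k z.1 | inr k => basis_coord k z.2 end.
Lemma prod_coord_linear j : linear (prod_coord j).
Proof. by case: j => k a u v; rewrite /prod_coord /= linearP. Qed.
HB.instance Definition _ j :=
  GRing.isLinear.Build _ _ _ _ (prod_coord j) (@prod_coord_linear j).

Lemma prod_coord_continuous j : continuous (prod_coord j).
Proof.
case: j => k x; rewrite /prod_coord /=.
  by apply: (continuous_comp (g := basis_coord k));
    [exact: prod_fst_continuous|exact: basis_coord_continuous].
by apply: (continuous_comp (g := basis_coord k));
  [exact: prod_snd_continuous|exact: basis_coord_continuous].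
Qed.

#[global] Program Instance findim_prod : findim (V * W)%type := {|
  basis_index := (basis_index V + basis_index W)%type;
  basis_vec := fun j => match j with inl k => (basis_vec k, 0) | inr k => (0, basis_vec k) end;
  basis_coord := fun j => prod_coord j : {linear _ -> _};
  basis_coord_continuous := prod_coord_continuous
|}.
Next Obligation.
move=> v; rewrite big_sumType/= [LHS]surjective_pairing.
have sE (I : finType) (F : I -> V * W) :
    \sum_i F i = (\sum_i (F i).1, \sum_i (F i).2).
  by elim: (index_enum I) => [|i r IH]; rewrite ?big_nil// !big_cons IH.
have z (I : finType) (U : normedModType R) (c : I -> R) :
    \sum_i c i *: (0 : U) = 0.
  by apply: big1 => i _; rewrite scaler0.
rewrite !sE /=; apply: (congr2 pair) => /=; rewrite z ?addr0 ?add0r; exact: basis_expand.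
Qed.
End Prod.
End FindimInstances.

(** * Calculus of locked directional derivatives *)

(** Locked, so that unification never unfolds derivatives into limits. *)
HB.lock Definition pd {R : realType} {V W : normedModType R} (f : V -> W)
  (x v : V) : W := 'D_v f x.

Section DirectionalDerivative.
Context {R : realType}.
Implicit Types U V W : normedModType R.

Lemma pdE V W (f : V -> W) x v : pd f x v = 'D_v f x.
Proof. by rewrite pd.unlock. Qed.

Lemma pd_fun V W (f : V -> W) v : (fun z => pd f z v) = 'D_v f.
Proof. by apply: funext => z; rewrite pdE. Qed.

Lemma smoothOn_pd V W {fV : findim V} (D : set V) (f : V -> W) (c : V -> V) :
  open D -> smoothOn D f -> smoothOn D c -> smoothOn D (fun z => pd f z (c z)).
Proof.
move=> oD sf sc; rewrite (_ : (fun z => _) = fun z => 'D_(c z) f z).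
  exact: smoothOn_derive_field.
by apply: funext => z; rewrite pdE.
Qed.

Lemma smoothOn_pd_const V W (D : set V) (f : V -> W) v :
  smoothOn D f -> smoothOn D (fun z => pd f z v).
Proof. by rewrite pd_fun; exact: smoothOn_derive. Qed.

Section OnOpen.
Variables (V : normedModType R) (D : set V).
Hypothesis oD : open D.

Lemma pd_linear W (f : V -> W) x : smoothOn D f -> D x -> linear (pd f x).
Proof.
move=> sf Dx a u v; rewrite !pdE.
exact: (derive_is_linear (smoothOn_differentiable sf Dx)).
Qed.

Section Vector.
Variables (W : normedModType R) (f : V -> W) (x : V).
Hypotheses (sf : smoothOn D f) (Dx : D x).
Lemma pdDr u v : pd f x (u + v) = pd f x u + pd f x v.
Proof. by have := pd_linear sf Dx 1 u v; rewrite !scale1r. Qed.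
Lemma pd0r : pd f x 0 = 0.
Proof. by apply: (addrI (pd f x 0)); rewrite -pdDr !addr0. Qed.
Lemma pdZr a v : pd f x (a *: v) = a *: pd f x v.
Proof. by have := pd_linear sf Dx a v 0; rewrite !addr0 pd0r addr0. Qed.
Lemma pdNr v : pd f x (- v) = - pd f x v.
Proof. by rewrite -scaleN1r pdZr scaleN1r. Qed.
Lemma pdBr u v : pd f x (u - v) = pd f x u - pd f x v.
Proof. by rewrite pdDr pdNr. Qed.
End Vector.

Lemma pd_eq W (f g : V -> W) x v : D x -> (forall y, D y -> f y = g y) ->
  pd f x v = pd g x v.
Proof.
by move=> Dx fg; rewrite !pdE; apply: near_eq_derive; exact: eq_on_near fg Dx.
Qed.

Lemma pd_cst W (c : W) x v : pd (fun _ : V => c) x v = 0.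
Proof. by rewrite pdE; exact: (derive_cst c). Qed.

Lemma pd_id (x v : V) : pd id x v = v.
Proof. by rewrite pdE; exact: derive_id. Qed.

Lemma pd_add W (f g : V -> W) x v : smoothOn D f -> smoothOn D g -> D x ->
  pd (fun z => f z + g z) x v = pd f x v + pd g x v.
Proof.
move=> sf sg Dx; rewrite !pdE; apply: derive_addf; exact: smoothOn_differentiable Dx.
Qed.

Lemma pd_sub W (f g : V -> W) x v : smoothOn D f -> smoothOn D g -> D x ->
  pd (fun z => f z - g z) x v = pd f x v - pd g x v.
Proof.
move=> sf sg Dx; rewrite !pdE; apply: derive_subf; exact: smoothOn_differentiable Dx.
Qed.

Lemma pd_scale W (k : V -> R) (g : V -> W) x v :
  smoothOn D k -> smoothOn D g -> D x ->
  pd (fun z => k z *: g z) x v = k x *: pd g x v + pd k x v *: g x.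
Proof.
move=> sk sg Dx; rewrite !pdE; apply: derive_scale; exact: smoothOn_differentiable Dx.
Qed.

Lemma pd_scalec W (k : R) (g : V -> W) x v : smoothOn D g -> D x ->
  pd (fun z => k *: g z) x v = k *: pd g x v.
Proof.
move=> sg Dx; rewrite (pd_scale (k := fun _ => k))//; last exact: smoothOn_cst.
by rewrite pd_cst scale0r addr0.
Qed.

Lemma pd_opp W (g : V -> W) x v : smoothOn D g -> D x ->
  pd (fun z => - g z) x v = - pd g x v.
Proof.
move=> sg Dx; rewrite -scaleN1r -pd_scalec//; apply: pd_eq => // y _.
by rewrite scaleN1r.
Qed.

Lemma pd_pair W W' (f : V -> W) (g : V -> W') x v :
  smoothOn D f -> smoothOn D g -> D x ->
  pd (fun z => (f z, g z)) x v = (pd f x v, pd g x v).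
Proof.
by move=> sf sg Dx; rewrite !pdE; apply: derive_pair; exact: smoothOn_differentiable Dx.
Qed.

Lemma pd_linear_comp W W' (l : {linear W -> W'}) (f : V -> W) x v : continuous l ->
  smoothOn D f -> D x -> pd (fun z => l (f z)) x v = l (pd f x v).
Proof.
move=> cl sf Dx; rewrite !pdE (derive_comp (g := l)).
- by rewrite derive_linear_map.
- exact: smoothOn_differentiable sf Dx.
- exact: linear_differentiable.
Qed.

Lemma pd_comp W W' (D' : set W) (g : W -> W') (f : V -> W) x v :
  smoothOn D f -> smoothOn D' g -> D x -> D' (f x) ->
  pd (fun z => g (f z)) x v = pd g (f x) (pd f x v).
Proof.
move=> sf sg Dx D'fx; rewrite !pdE; apply: derive_comp.
  exact: smoothOn_differentiable sf Dx.
exact: smoothOn_differentiable sg D'fx.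
Qed.

Lemma pd_family W W' {fW : findim W} (F : V -> W -> W') (c : V -> W) x w :
  D x -> (forall z, D z -> linear (F z)) ->
  (forall v, smoothOn D (F ^~ v)) -> smoothOn D c ->
  pd (fun z => F z (c z)) x w = pd (F ^~ (c x)) x w + F x (pd c x w).
Proof.
move=> Dx lF sF sc; rewrite !pdE; apply: (derive_family (D := D)) => //.
  by move=> v; exact: smoothOn_differentiable (sF v) Dx.
exact: smoothOn_differentiable sc Dx.
Qed.

(** When the direction of the inner derivative moves with the point, the outer
derivative also acts on the direction; this is the rule behind brackets and
covariant derivatives. *)
Lemma pd_pd W {fV : findim V} (f : V -> W) (c : V -> V) x w :
  D x -> smoothOn D f -> smoothOn D c ->
  pd (fun z => pd f z (c z)) x w
  = pd (fun z => pd f z (c x)) x w + pd f x (pd c x w).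
Proof.
move=> Dx sf sc; apply: (pd_family (F := pd f)) => //.
  by move=> z Dz; exact: pd_linear.
by move=> v; exact: smoothOn_pd_const.
Qed.

Lemma pd_sym W {fW : findim W} (f : V -> W) x v w : D x -> smoothOn D f ->
  pd (fun z => pd f z v) x w = pd (fun z => pd f z w) x v.
Proof. by move=> Dx sf; rewrite !pd_fun !pdE; exact: schwarz Dx sf. Qed.

End OnOpen.

End DirectionalDerivative.
(** * Tangent vectors and smooth fields in charts *)
#[global] Program Instance findim_R (R : realType) : @findim R R := {|
  basis_index := unit; basis_vec := fun=> 1; basis_coord := fun=> idfun : {linear R -> R} |}.
Next Obligation. by move=> R j x; exact: cvg_id. Qed.
Next Obligation. by move=> R v; rewrite (big_pred1 tt)//= [RHS]mulr1. Qed.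

Lemma open_setI_preimage (T S : topologicalType) (f : T -> S) (D : set T)
  (D' : set S) : open D -> open D' ->
  (forall x, D x -> f @ x --> f x) -> open (D `&` f @^-1` D').
Proof.
move=> oD oD' cf; rewrite openE => x [Dx D'fx].
rewrite /interior; apply: filterI; first exact: open_nbhs_nbhs.
by apply: (cf x Dx); exact: open_nbhs_nbhs.
Qed.

(** The base manifold and the slit bundle both satisfy this.  Everything in
this part follows from it: smoothness can be tested in a single chart, and a
tangent vector has unique components in each chart. *)
Record atlas (R : realType) (P : pspace R) : Prop := Atlas {
  pdom_open : forall i : pix P, open (@pdom R P i);
  param_inj : forall (i : pix P) x y, @pdom R P i x -> @pdom R P i y ->
    @param R P i x = @param R P i y -> x = y;
  change_chart : forall (i j : pix P) x y, @pdom R P i x -> @pdom R P j y ->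
    @param R P i x = @param R P j y ->
    exists (O : set (model P)) (T : model P -> model P),
      [/\ open O, O x, O `<=` @pdom R P i, smoothOn O T &
          forall z, O z -> @pdom R P j (T z) /\ @param R P j (T z) = @param R P i z]
}.

Section Tangent.
Context {R : realType} {P : pspace R} {fP : findim (model P)}.

Lemma smooth_at_chart_near i x (g : P -> R) : pdom i x ->
  smooth_at (param i x) g ->
  exists O : set (model P), [/\ open O, O x & smoothOn O (g \o param i)].
Proof. by move=> ix sg; exact/smooth_nearP/sg. Qed.

Lemma on_smooth_in p (v : der P) g : smooth_at p g -> on_smooth p v g = v g.
Proof. by rewrite /on_smooth => sg; case: asboolP. Qed.

Lemma on_smooth_out p (v : der P) g : ~ smooth_at p g -> on_smooth p v g = 0.
Proof. by rewrite /on_smooth => sg; case: asboolP. Qed.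

Lemma dirder_in i x a g : smooth_at (param i x) g ->
  @dirder R P i x a g = pd (g \o param i) x a.
Proof. by move=> sg; rewrite /dirder on_smooth_in// pdE. Qed.

Lemma dirder_out i x a g : ~ smooth_at (param i x) g ->
  @dirder R P i x a g = 0.
Proof. exact: on_smooth_out. Qed.

Lemma dirder_lin i x : pdom i x -> linear (@dirder R P i x).
Proof.
move=> ix c a b; apply: funext => g; rewrite !fctE.
case: (pselect (smooth_at (param i x) g)) => sg; last first.
  by rewrite !dirder_out// scaler0 addr0.
rewrite !dirder_in//; have [ O [oO Ox sO]] := smooth_at_chart_near ix sg.
exact: (pd_linear sO Ox).
Qed.

Lemma dirderD i x a b : pdom i x ->
  @dirder R P i x (a + b) = dirder i x a + dirder i x b.
Proof. by move=> ix; have := dirder_lin ix 1 a b; rewrite !scale1r. Qed.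
Lemma dirder0 i x : pdom i x -> @dirder R P i x 0 = 0.
Proof. by move=> ix; apply: (addrI (dirder i x 0)); rewrite -dirderD// !addr0. Qed.
Lemma dirderZ i x c a : pdom i x ->
  @dirder R P i x (c *: a) = c *: dirder i x a.
Proof. by move=> ix; have := dirder_lin ix c a 0; rewrite dirder0// !addr0. Qed.
Lemma dirderN i x a : pdom i x -> @dirder R P i x (- a) = - dirder i x a.
Proof. by move=> ix; rewrite -scaleN1r dirderZ// scaleN1r. Qed.
Lemma dirderB i x a b : pdom i x ->
  @dirder R P i x (a - b) = dirder i x a - dirder i x b.
Proof. by move=> ix; rewrite dirderD// dirderN. Qed.

Section Atlas.
Hypothesis aP : atlas P.

(** Smoothness at a point is required in every chart around it; composing with
the change of charts transports it from one. *)
Lemma smooth_at_chart i x (g : P -> R) (O : set (model P)) :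
  open O -> O x -> pdom i x -> smoothOn O (g \o param i) ->
  smooth_at (param i x) g.
Proof.
move=> oO Ox ix sg j y jy E.
have [ O' [T [oO' O'y O'j sT TE]]] := change_chart aP jy ix E.
apply/smooth_nearP; exists (O' `&` T @^-1` O); split.
- apply: open_setI_preimage => // z O'z.
  exact: sT 0%N z O'z.
- split=> //=; have [iT ET] := TE _ O'y.
  by rewrite (param_inj aP iT ix) // ET.
- have oOT : open (O' `&` T @^-1` O).
    apply: open_setI_preimage => // z O'z; exact: sT 0%N z O'z.
  apply: (smoothOn_eq (f := fun z => (g \o param i) (T z))) => //.
    by move=> z [ O'z _] /=; rewrite (TE _ O'z).2.
  apply: (smoothOn_comp (D' := O)) => //; last by move=> z [].
  by apply: smoothOn_subset sT => z [].
Qed.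

Lemma dirder_change i j (O : set (model P)) (T : model P -> model P) x a :
  open O -> O x -> smoothOn O T -> (forall z, O z -> pdom i z) ->
  (forall z, O z -> @pdom R P j (T z) /\ @param R P j (T z) = @param R P i z) ->
  @dirder R P i x a = dirder j (T x) (pd T x a).
Proof.
move=> oO Ox sT Oi TE; have [jT ET] := TE _ Ox; apply: funext => g.
case: (pselect (smooth_at (param i x) g)) => sg; last first.
  by rewrite !dirder_out// ET.
rewrite !dirder_in ?ET//.
have sg' : smooth_at (param j (T x)) g by rewrite ET.
have [ O' [oO' O'x sO']] := smooth_at_chart_near jT sg'.
rewrite (@pd_eq _ _ O oO _ (g \o param i) (fun z => (g \o param j) (T z))) //.
  by rewrite (pd_comp _ sT sO').
by move=> z Oz /=; rewrite (TE _ Oz).2.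
Qed.

Lemma dirder_chart i j x y b : pdom i x -> pdom j y ->
  param i x = param j y -> exists a, @dirder R P j y b = dirder i x a.
Proof.
move=> ix jy E; have [ O [T [oO Oy Oj sT TE]]] := change_chart aP jy ix (esym E).
have Tyx : T y = x by apply: (param_inj aP (TE _ Oy).1 ix); rewrite (TE _ Oy).2.
by exists (pd T y b); rewrite (dirder_change b oO Oy sT Oj TE) Tyx.
Qed.

Lemma tangent_chart i x v : pdom i x -> tangent (param i x) v ->
  exists a, v = @dirder R P i x a.
Proof.
move=> ix [j [y [b [jy E ->]]]]; have [a ->] := dirder_chart b ix jy (esym E).
by exists a.
Qed.

Lemma dirder_tangent i x a : pdom i x -> tangent (param i x) (@dirder R P i x a).
Proof. by move=> ix; exists i, x, a. Qed.

Definition chart_inv (i : pix P) (p : P) : model P :=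
  xget 0 [set z | pdom i z /\ param i z = p].

Lemma chart_invK i x : pdom i x -> chart_inv i (param i x) = x.
Proof.
move=> ix; rewrite /chart_inv; case: xgetP => [y _ [iy E]|H].
  exact: param_inj E.
by case: (H x).
Qed.

Definition chart_coord (i : pix P) (k : @basis_index R _ fP) (p : P) : R :=
  basis_coord k (chart_inv i p).

Lemma chart_coordE i k x : pdom i x -> (chart_coord i k \o param i) x = basis_coord k x.
Proof. by move=> ix; rewrite /= /chart_coord chart_invK. Qed.

Lemma chart_coord_smooth i k x : pdom i x -> smooth_at (param i x) (chart_coord i k).
Proof.
move=> ix; have oi := pdom_open aP i; apply: (smooth_at_chart oi) => //.
apply: (smoothOn_eq (f := basis_coord k)) => // [z iz|]; first by rewrite chart_coordE.
by apply: smoothOn_linear_map => //; exact: basis_coord_continuous.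
Qed.

Lemma dirder_chart_coord i k x a : pdom i x ->
  @dirder R P i x a (chart_coord i k) = basis_coord k a.
Proof.
move=> ix; rewrite dirder_in; last exact: chart_coord_smooth.
have oi := pdom_open aP i.
rewrite (@pd_eq _ _ (pdom i) oi _ _ (basis_coord k) x a ix); last first.
  by move=> y iy; rewrite chart_coordE.
by rewrite pdE derive_linear_map//; exact: basis_coord_continuous.
Qed.

(** The coordinate functions are smooth, so they detect the components. *)
Lemma dirder_inj i x a b : pdom i x -> @dirder R P i x a = dirder i x b -> a = b.
Proof.
move=> ix E; rewrite (basis_expand a) (basis_expand b); apply: eq_bigr => k _.
by rewrite -!(dirder_chart_coord k _ ix) E.
Qed.

Lemma smooth_at_nbhs i x (g : P -> R) : pdom i x -> smooth_at (param i x) g ->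
  exists O : set (model P), [/\ open O, O x, O `<=` pdom i,
    smoothOn O (g \o param i) & forall z, O z -> smooth_at (param i z) g].
Proof.
move=> ix sg; have [ O [oO Ox sO]] := smooth_at_chart_near ix sg.
have oi := pdom_open aP i.
have oOi : open (O `&` pdom i) by exact: openI.
have sOi : smoothOn (O `&` pdom i) (g \o param i) by apply: smoothOn_subset sO => z [].
exists (O `&` pdom i); split=> // z [Oz iz].
exact: (smooth_at_chart oOi).
Qed.

Lemma smoothOn_chart i (g : P -> R) :
  (forall x, pdom i x -> smooth_at (param i x) g) ->
  smoothOn (pdom i) (g \o param i).
Proof.
move=> sg; apply: smoothOn_local => x ix.
by have [ O [oO Ox _ sO _]] := smooth_at_nbhs ix (sg _ ix); exists O.
Qed.

(** Coordinates are read off by applying the derivation to the coordinate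
functions; for a smooth field this makes its components smooth. *)
Definition components i (v : der P) : model P :=
  \sum_(k : basis_index (model P)) v (chart_coord i k) *: basis_vec k.

Lemma components_dirder i x a : pdom i x -> components i (@dirder R P i x a) = a.
Proof.
move=> ix; rewrite [RHS]basis_expand; apply: eq_bigr => k _.
by rewrite dirder_chart_coord.
Qed.

Lemma tangentE i x v : pdom i x -> tangent (param i x) v ->
  v = @dirder R P i x (components i v).
Proof.
move=> ix /(tangent_chart ix)[a ->]; by rewrite components_dirder.
Qed.

(** The field X has the smooth components xi in the chart i. *)
Definition vrep i (X : vfield P) (xi : model P -> model P) : Prop :=
  smoothOn (pdom i) xi /\ forall z, pdom i z -> X (param i z) = @dirder R P i z (xi z).

Lemma vrep_exists i X : smooth_vfield X ->
  vrep i X (fun z => components i (X (param i z))).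
Proof.
move=> sX; have oi := pdom_open aP i; split=> [|z iz]; last first.
  by rewrite -tangentE//; apply: (sX _ _).1; exists i, z.
have H k : smoothOn (pdom i) ((fun w => X w (chart_coord i k)) \o param i).
  apply: smoothOn_chart => x ix; apply: (sX _ _).2; first by exists i, x.
  exact: chart_coord_smooth.
move=> n; apply: Ckv_sum => // k; apply: Ckv_scale => //; last exact: Ckv_cst.
exact: H k n.
Qed.

Lemma vrep_apply i X xi x f : vrep i X xi -> pdom i x ->
  smooth_at (param i x) f -> X (param i x) f = pd (f \o param i) x (xi x).
Proof. by move=> [_ E] ix sf; rewrite E// dirder_in. Qed.

Lemma smooth_at_vrep i X xi x f : vrep i X xi -> pdom i x ->
  smooth_at (param i x) f -> smooth_at (param i x) (fun w => X w f).
Proof.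
move=> rX ix sf; have [ O [oO Ox Oi sO sfO]] := smooth_at_nbhs ix sf.
apply: (smooth_at_chart oO) => //.
apply: (smoothOn_eq (f := fun z => pd (f \o param i) z (xi z))) => //.
  by move=> z Oz /=; rewrite (vrep_apply rX)//; [exact: Oi|exact: sfO].
by apply: smoothOn_pd => //; apply: smoothOn_subset Oi rX.1.
Qed.

(** The second derivatives of the test function cancel by symmetry, which is
also why the bracket is again a tangent vector. *)
Lemma vrep_bracket i X Y xi eta : vrep i X xi -> vrep i Y eta ->
  vrep i (bracket X Y) (fun z => pd eta z (xi z) - pd xi z (eta z)).
Proof.
move=> rX rY; have oi := pdom_open aP i; split.
  by apply: smoothOn_minus => //; apply: smoothOn_pd => //;
    [exact: rY.1|exact: rX.1|exact: rX.1|exact: rY.1].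
move=> x ix; apply: funext => f; rewrite /bracket.
case: (pselect (smooth_at (param i x) f)) => sf; last first.
  by rewrite on_smooth_out// dirder_out.
rewrite on_smooth_in// dirder_in//.
have [ O [oO Ox Oi sO sfO]] := smooth_at_nbhs ix sf.
have E (X1 Y1 : vfield P) xi1 eta1 : vrep i X1 xi1 -> vrep i Y1 eta1 ->
    X1 (param i x) (fun w => Y1 w f) =
    pd (fun z => pd (f \o param i) z (eta1 x)) x (xi1 x) +
    pd (f \o param i) x (pd eta1 x (xi1 x)).
  move=> r1 r2; rewrite (vrep_apply r1) //; last exact: (smooth_at_vrep r2).
  rewrite (@pd_eq _ _ O oO _ _ (fun z => pd (f \o param i) z (eta1 z))) //.
    by rewrite (pd_pd oO)//; apply: smoothOn_subset Oi r2.1.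
  by move=> z Oz /=; rewrite (vrep_apply r2)//; [exact: Oi|exact: sfO].
rewrite (E X Y xi eta)// (E Y X eta xi)// (pdBr sO Ox).
by rewrite (@pd_sym _ _ _ oO _ (findim_R R) (f \o param i) x (eta x) (xi x) Ox sO)
  opprD addrACA subrr add0r.
Qed.

End Atlas.
End Tangent.

(** * The slit bundle *)
Section PairCalculus.
Context {R : realType} {n : nat}.
#[local] Notation V := 'rV[R]_n.
#[local] Notation E := ('rV[R]_n * 'rV[R]_n)%type.

Lemma open_fst (A : set V) : open A -> open [set z : E | A z.1].
Proof.
move=> oA; apply: (@open_comp _ _ (fst : E -> V) A) => // z _.
exact: prod_fst_continuous.
Qed.

Lemma open_snd_neq0 : open [set z : E | z.2 != 0].
Proof.
apply: (@open_comp _ _ (snd : E -> V) [set v | v != 0]) => [z _|].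
  exact: prod_snd_continuous.
rewrite (_ : [set v | _] = ~` [set 0]); last first.
  by apply/seteqP; split=> v /= /eqP.
rewrite openC; apply: accessible_closed_set1.
by apply: hausdorff_accessible; exact: norm_hausdorff.
Qed.

Lemma smoothOn_fst (D : set E) : open D -> smoothOn D (fst : E -> V).
Proof. by move=> oD; apply: (smoothOn_linear_map (l := fst)) => //; exact: prod_fst_continuous. Qed.

Lemma smoothOn_snd (D : set E) : open D -> smoothOn D (snd : E -> V).
Proof. by move=> oD; apply: (smoothOn_linear_map (l := snd)) => //; exact: prod_snd_continuous. Qed.

Lemma pd_fst (z w : E) : pd (fst : E -> V) z w = w.1.
Proof. by rewrite pdE; apply: (derive_linear_map (l := fst)); exact: prod_fst_continuous. Qed.

Lemma pd_snd (z w : E) : pd (snd : E -> V) z w = w.2.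
Proof. by rewrite pdE; apply: (derive_linear_map (l := snd)); exact: prod_snd_continuous. Qed.

Lemma smoothOn_comp_fst (W : normedModType R) (D : set E) (A : set V)
  (f : V -> W) : open D -> (forall z, D z -> A z.1) -> smoothOn A f ->
  smoothOn D (fun z => f z.1).
Proof.
move=> oD DA sf; apply: (smoothOn_comp (T := fst) (D' := A)) => //.
exact: smoothOn_fst.
Qed.

Lemma smoothOn_pd_fst (W : normedModType R) (D : set E) (A : set V)
  (f : V -> W) (c : E -> V) : open D -> (forall z, D z -> A z.1) ->
  smoothOn A f -> smoothOn D c -> smoothOn D (fun z => pd f z.1 (c z)).
Proof.
move=> oD DA sf sc; apply: (smoothOn_family (F := fun z v => pd f z.1 v)) => //.
  by move=> z Dz; exact: pd_linear sf (DA _ Dz).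
move=> v; apply: (smoothOn_comp_fst (f := fun x => pd f x v) oD DA).
exact: smoothOn_pd_const.
Qed.

End PairCalculus.

Section SlitAtlas.
Context {R : realType} {n : nat} (M : manifold R n).

#[local] Notation V := 'rV[R]_n.
#[local] Notation E := ('rV[R]_n * 'rV[R]_n)%type.
#[local] Notation bdom := (@pdom R (base M)).
#[local] Notation sdom := (@pdom R (slit M)).
#[local] Notation bdir := (@dirder R (base M)).

(** The models of the two spaces are convertible to row vectors and pairs of
them, but instance resolution does not unfold them. *)
#[global] Instance findim_base : findim (model (base M)) := findim_rV n.
#[global] Instance findim_slit : findim (model (slit M)) :=
  @findim_prod R _ _ (findim_rV n) (findim_rV n).

Lemma atlas_base : atlas (base M).
Proof.
split=> [i|i x y|i j x y].
- exact: chart_img_open.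
- by move=> [p ip <-] [q iq <-] /=; rewrite !coordK// => ->.
- move=> [p ip <-] [q jq <-] /=; rewrite !coordK// => pq.
  pose T (z : V) := coord j (chart_param i z).
  pose O : set V := bdom i `&` @chart_param R n M i @^-1` chart_dom j.
  have oO : open O.
    apply: open_setI_preimage; [exact: chart_img_open|exact: chart_dom_open|].
    by move=> _ [r ir <-]; exact: param_continuous.
  exists O, T; split=> //.
  + by split; [exists p|rewrite /= coordK// pq].
  + by move=> z [].
  + apply: smoothOn_coords => // k; apply: smoothOn_local => z [[r ir <-]].
    rewrite /= coordK// => jr.
    by have /smooth_nearP := transition_smooth ir jr k.
  + move=> z [_ jz]; split; first by exists (chart_param i z).
    by rewrite /= /T coordK.
Qed.

Lemma slit_fst i z : sdom i z -> bdom i z.1.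
Proof. by case. Qed.

(** A change of charts phi of the base induces (x, y) |-> (phi x, dphi_x y);
y is nonzero if and only if dphi_x y is, because both are components of the
same tangent vector. *)
Lemma atlas_slit : atlas (slit M).
Proof.
have aB := atlas_base.
have oD i : open (sdom i).
  have -> : sdom i = [set z : E | bdom i z.1] `&` [set z : E | z.2 != 0] by [].
  by apply: openI; [apply: open_fst; exact: pdom_open aB i|exact: open_snd_neq0].
split=> // [i [x a] [y b] [/= ix _] [/= iy _] [E1]|i j [x a] [y b] [/= ix a0] [/= jy b0] [E1 E2]].
  have xy : x = y by exact: (param_inj aB ix iy E1).
  by move: iy; rewrite -xy => iy /(dirder_inj aB ix) ->.
have [ O [T [oO Ox Oi sT TE]]] := change_chart aB ix jy E1.
pose O' : set E := [set z : E | O z.1] `&` [set z : E | z.2 != 0].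
have oO' : open O' by apply: openI; [exact: open_fst|exact: open_snd_neq0].
have ch z : O z.1 -> bdir i z.1 z.2 = bdir j (T z.1) (pd T z.1 z.2).
  by move=> Oz; exact: (dirder_change _ oO Oz sT Oi TE).
exists O', (fun z => (T z.1, pd T z.1 z.2)); split=> //.
- by move=> z [Oz z0]; split=> //; exact: Oi.
- apply: smoothOn_pair => //.
    by apply: (smoothOn_comp_fst (A := O)) => // z [].
  apply: (smoothOn_pd_fst (A := O) (c := snd)) => //; first by move=> z [].
  exact: smoothOn_snd.
- move=> z [Oz z0]; split=> /=.
    split; first exact: (TE _ Oz).1.
    apply: contra z0 => /eqP /= T0; apply/eqP.
    apply: (dirder_inj aB (Oi _ Oz)).
    by rewrite ch// T0 !dirder0//; [exact: Oi|exact: (TE _ Oz).1].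
  rewrite /TM_param /= ch//; apply: (congr2 pair) => //; exact: (TE _ Oz).2.
Qed.

End SlitAtlas.

Section PiFields.
Context {R : realType} {n : nat} (M : manifold R n).

#[local] Notation V := 'rV[R]_n.
#[local] Notation E := ('rV[R]_n * 'rV[R]_n)%type.
#[local] Notation bdom := (@pdom R (base M)).
#[local] Notation sdom := (@pdom R (slit M)).
#[local] Notation spar := (@param R (slit M)).
#[local] Notation bdir := (@dirder R (base M)).
#[local] Notation sdir := (@dirder R (slit M)).
#[local] Notation slitA := (atlas_slit M).
#[local] Notation baseA := (atlas_base M).

Lemma sdom_open i : open (sdom i).
Proof. exact: pdom_open slitA i. Qed.

(** The pi-vector field Y has the smooth components a in the chart i. *)
Definition prep i (Y : pifield M) (a : E -> V) : Prop :=
  smoothOn (sdom i) a /\ forall z, sdom i z -> Y (spar i z) = bdir i z.1 (a z).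

Lemma sdom_points i z : sdom i z -> points (spar i z).
Proof. by move=> iz; exists i, z. Qed.

Lemma prep_exists i Y : smooth_pifield Y ->
  prep i Y (fun z => @components R (base M) _ i (Y (spar i z))).
Proof.
move=> sY; have oi := @sdom_open i; split=> [|z iz]; last first.
  by apply: (tangentE baseA (slit_fst iz)); exact: (sY (spar i z) (sdom_points iz)).1.
have H k : smoothOn (sdom i) ((fun w => Y w (@chart_coord R (base M) _ i k)) \o spar i).
  apply: (smoothOn_chart slitA) => z iz; apply: (sY (spar i z) (sdom_points iz)).2.
  exact: (chart_coord_smooth baseA k (slit_fst iz)).
move=> m; apply: Ckv_sum => // k; apply: Ckv_scale => //; last exact: Ckv_cst.
exact: H k m.
Qed.

Lemma smooth_pifield_charts (Y : pifield M) :
  (forall i, exists a, prep i Y a) -> smooth_pifield Y.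
Proof.
move=> H u [i [z [iz <-]]]; have [a [sa Ea]] := H i; split.
  by rewrite Ea//; exact: (dirder_tangent _ (slit_fst iz)).
move=> g sg; have [ O [oO Oz Oi sO sgO]] := smooth_at_nbhs baseA (slit_fst iz) sg.
have oi := @sdom_open i.
have oO' : open (sdom i `&` [set z : E | O z.1]) by apply: openI => //; exact: open_fst.
apply: (smooth_at_chart slitA oO') => //.
apply: (smoothOn_eq (f := fun z => pd (g \o @param R (base M) i) z.1 (a z))) => //.
  by move=> w [iw Ow] /=; rewrite Ea// dirder_in//; exact: sgO.
apply: (smoothOn_pd_fst (A := O)) => //; first by move=> w [].
by apply: smoothOn_subset sa => w [].
Qed.

(** The two limits defining the derivatives are those of the same quotient. *)
Lemma gamma_chart i z a : sdom i z -> gamma (spar i z) (bdir i z.1 a) = sdir i z (0, a).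
Proof.
move=> iz; apply: funext => f; rewrite /gamma.
case: (pselect (smooth_at (spar i z) f)) => sf; last first.
  by rewrite on_smooth_out// dirder_out.
rewrite on_smooth_in// [RHS]dirder_in// pdE /derive1 /derive.
set g1 := fun h => h^-1 *: _; set g2 := fun h => h^-1 *: _.
suff -> : g1 = g2 by []; apply: funext => h; rewrite /g1 /g2 /=.
rewrite /TM_param /= scaler0 !add0r addr0 scale0r addr0.
by rewrite (dirderD _ _ (slit_fst iz)) (dirderZ _ _ (slit_fst iz)) [h *: _ + _]addrC.
Qed.

Lemma rho_chart i z w : sdom i z -> rho (spar i z) (sdir i z w) = bdir i z.1 w.1.
Proof.
move=> iz; apply: funext => g; rewrite /rho.
have bz := slit_fst iz.
case: (pselect (@smooth_at R (base M) (@param R (base M) i z.1) g)) => sg; last first.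
  by rewrite on_smooth_out// dirder_out.
rewrite on_smooth_in// (dirder_in _ sg).
have [ O [oO Oz Oi sO sgO]] := smooth_at_nbhs baseA bz sg.
have oi := @sdom_open i.
have oO' : open (sdom i `&` [set z : E | O z.1]) by apply: openI => //; exact: open_fst.
have sf : smoothOn (sdom i `&` [set z : E | O z.1])
    (fun z : E => (g \o @param R (base M) i) z.1).
  by apply: (smoothOn_comp_fst (A := O)) => // y [].
rewrite dirder_in; last exact: (smooth_at_chart slitA oO').
have s1 : smoothOn [set: E] (fst : E -> V) by apply: smoothOn_fst; exact: openT.
rewrite -[in RHS](pd_fst z w) -(pd_comp _ s1 sO)//.
Qed.

Lemma vrep_gamma i Y a : prep i Y a -> vrep i (gammaf Y) (fun z => (0, a z)).
Proof.
move=> [sa Ea]; split=> [|z iz]; last by rewrite /gammaf Ea// gamma_chart.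
by apply: smoothOn_pair => //; [exact: sdom_open|exact: smoothOn_cst].
Qed.

Lemma prep_rho i X (xi : E -> E) : vrep (P := slit M) i X xi ->
  prep i (rhof X) (fun z => (xi z).1).
Proof.
move=> [sxi Exi]; split=> [|z iz]; last by rewrite /rhof Exi// rho_chart.
apply: (smoothOn_linear_comp (l := fst)) => //; [exact: sdom_open|exact: prod_fst_continuous].
Qed.

Lemma vrep_J i X (xi : E -> E) : vrep (P := slit M) i X xi ->
  vrep i (Jf X) (fun z => (0, (xi z).1)).
Proof. by move=> rX; apply: vrep_gamma; exact: prep_rho. Qed.

Lemma prep_eta i : prep i (@eta R n M) snd.
Proof.
split=> //; apply: smoothOn_snd; exact: sdom_open.
Qed.

Lemma smooth_eta : smooth_pifield (@eta R n M).
Proof. by apply: smooth_pifield_charts => i; exists snd; exact: prep_eta. Qed.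

Lemma vrep_add i X X' (xi xi' : E -> E) :
  vrep (P := slit M) i X xi -> vrep i X' xi' ->
  vrep i (fun u => X u + X' u) (fun z => xi z + xi' z).
Proof.
move=> [s e] [s' e']; split=> [|z iz].
  by apply: smoothOn_add => //; exact: sdom_open.
by rewrite e// e'// (dirderD _ _ iz).
Qed.

Lemma vrep_scale i X (k : M * der (base M) -> R) (xi : E -> E) :
  smoothOn (sdom i) (k \o spar i) -> vrep (P := slit M) i X xi ->
  vrep i (fun u => k u *: X u) (fun z => (k \o spar i) z *: xi z).
Proof.
move=> sk [s e]; split=> [|z iz].
  by apply: smoothOn_scale => //; exact: sdom_open.
by rewrite e// (dirderZ _ _ iz).
Qed.

Lemma vrep_sub i X X' (xi xi' : E -> E) :
  vrep (P := slit M) i X xi -> vrep i X' xi' ->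
  vrep i (fun u => X u - X' u) (fun z => xi z - xi' z).
Proof.
move=> [s e] [s' e']; split=> [|z iz].
  by apply: smoothOn_minus => //; exact: sdom_open.
by rewrite e// e'// (dirderB _ _ iz).
Qed.

Lemma vrep_ext i X (xi xi' : E -> E) : (forall z, sdom i z -> xi z = xi' z) ->
  vrep (P := slit M) i X xi -> vrep i X xi'.
Proof.
move=> E0 [s e]; split=> [|z iz]; last by rewrite (e _ iz) (E0 _ iz).
exact: (smoothOn_eq (@sdom_open i) E0 s).
Qed.

Lemma prep_add i Y Y' a a' : prep i Y a -> prep i Y' a' ->
  prep i (fun u => Y u + Y' u) (fun z => a z + a' z).
Proof.
move=> [s e] [s' e']; split=> [|z iz].
  by apply: smoothOn_add => //; exact: sdom_open.
by rewrite e// e'// (dirderD _ _ (slit_fst iz)).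
Qed.

Lemma prep_ext i Y a a' : (forall z, sdom i z -> a z = a' z) ->
  prep i Y a -> prep i Y a'.
Proof.
move=> E0 [s e]; split=> [|z iz]; last by rewrite (e _ iz) (E0 _ iz).
exact: (smoothOn_eq (@sdom_open i) E0 s).
Qed.

End PiFields.

(** * Bump functions and global fields *)
Section FlatFunction.
Context {R : realType}.

(** The functions t^(-m) exp(-1/t), extended by 0: the derivative of each is a
combination of two others, so their common smoothness is proved by one
induction. *)
Definition flat (m : nat) (t : R) : R :=
  if 0 < t then t^-1 ^+ m * expR (- t^-1) else 0.

(** The exponential dominates the monomial of degree m + 2; the quadratic bound
makes the derivative vanish at 0. *)
Lemma flat_le m (t : R) : 0 < t -> flat m t <= m.+2`!%:R * t ^+ 2.
Proof.
move=> t0; rewrite /flat t0 expRN.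
have s0 : 0 < t^-1 by rewrite invr_gt0.
have f0 : 0 < (m.+2`!%:R : R) by rewrite ltr0n fact_gt0.
have h : t^-1 ^+ m.+2 / m.+2`!%:R <= expR t^-1.
  apply: le_trans (expR_ge1Dxn m.+1 (ltW s0)); by rewrite lerDr.
rewrite ler_pdivrMr ?expR_gt0//.
have -> : t^-1 ^+ m = t ^+ 2 * t^-1 ^+ m.+2.
  by rewrite -(addn2 m) exprD mulrCA -exprMn divff ?expr1n ?mulr1 ?gt_eqF.
rewrite [m.+2`!%:R * _]mulrC -[leRHS]mulrA ler_pM2l ?exprn_gt0//.
by rewrite mulrC -ler_pdivrMr// mulrC.
Qed.

Lemma flat_ge0 m (t : R) : 0 <= flat m t.
Proof.
rewrite /flat; case: ifPn => // t0.
by rewrite mulr_ge0 ?expR_ge0// exprn_ge0// invr_ge0 ltW.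
Qed.

Lemma is_derive_flat_pos m (t : R) : 0 < t ->
  is_derive t 1 (flat m) (flat m.+2 t - m%:R * flat m.+1 t).
Proof.
move=> t0.
have tN : t != 0 by rewrite gt_eqF.
have dV : is_derive t 1 (fun s : R => s^-1) (- t ^- 2).
  apply: (is_derive_eq (is_deriveV (f := id) tN (is_derive_id t 1))).
  by rewrite [LHS]mulr1.
have dX : is_derive t 1 ((fun s : R => s^-1) ^+ m)
    ((m%:R * t^-1 ^+ m.-1) *: (- t ^- 2)) by exact: is_deriveX.
have dE : is_derive t 1 (fun s : R => expR (- s^-1)) (expR (- t^-1) * t ^- 2).
  have dN : is_derive t 1 (fun s : R => - s^-1) (t ^- 2).
    by apply: (is_derive_eq (is_deriveN (f := fun s : R => s^-1) _)); rewrite opprK.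
  exact: (is_derive1_comp (f := expR) (g := fun s => - s^-1)).
have dM := is_deriveM dX dE.
apply: (@near_eq_is_derive _ _ _ (((fun s : R => s^-1) ^+ m) * (fun s : R => expR (- s^-1)))).
  near=> s; rewrite /flat (_ : 0 < s); last by near: s; exact: lt_nbhsr.
  by rewrite !fctE.
apply: (is_derive_eq dM).
rewrite /flat t0 !fctE /GRing.scale /=.
rewrite mulrN mulrN; congr (_ - _).
  by rewrite mulrA mulrAC -exprVn -exprD addn2.
case: m {dX dM} => [|m]; first by rewrite !mul0r mulr0.
have -> : t^-1 ^+ m.+2 = t^-1 ^+ m * t ^- 2 by rewrite -exprVn -exprD addn2.
by rewrite mulrC !mulrA.
Unshelve. all: by end_near. Qed.

Lemma is_derive_flat m (t : R) :
  is_derive t 1 (flat m) (flat m.+2 t - m%:R * flat m.+1 t).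
Proof.
have flat0 j (s : R) : s <= 0 -> flat j s = 0 by rewrite /flat leNgt => /negbTE ->.
case: (ltgtP 0 t) => [|t0|<-]; first exact: is_derive_flat_pos.
  rewrite !flat0 ?ltW// mulr0 subrr.
  apply: (@near_eq_is_derive _ _ _ (cst 0)).
  by near=> s; rewrite flat0// ltW//; near: s; exact: lt_nbhsl.
rewrite !flat0// mulr0 subrr.
have lim0 : (h^-1 *: ((flat m \o shift 0) (h *: (1 : R)) - flat m 0)) @[h --> 0^'] --> (0 : R).
  apply/cvgrPdist_le => e e0; near=> h.
  have C0 : 0 < (m.+2`!%:R : R) by rewrite ltr0n fact_gt0.
  rewrite sub0r normrN /= addr0 (flat0 m 0)// subr0 [h *: 1]mulr1.
  have [h0|h0] := leP h 0; first by rewrite flat0// scaler0 normr0 ltW.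
  rewrite normrZ (ger0_norm (flat_ge0 _ _)) normfV gtr0_norm//.
  rewrite ler_pdivrMl//; apply: le_trans (flat_le _ h0) _.
  rewrite expr2 mulrCA ler_pM2l// mulrC -ler_pdivlMr//.
  apply: le_trans (ler_norm _) _.
  by near: h; apply: dnbhs0_le; rewrite divr_gt0.
by apply: DeriveDef; [apply/cvg_ex; exists 0|exact: cvg_lim lim0].
Unshelve. all: by end_near. Qed.

Lemma flat_smooth m (D : set R) : smoothOn D (flat m).
Proof.
suff H : forall k j, Ckv k [set: R] (flat j).
  by move=> k; apply: Ckv_subset (H k m).
have df j t : differentiable (flat j) t.
  by apply/derivable1_diffP; have [] := is_derive_flat j t.
elim=> [|k IH] j; first by move=> t _; exact: differentiable_continuous.
split=> [t _|v]; first exact: df.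
have oT : open [set: R] by exact: openT.
have c1 : Ckv k [set: R] (fun _ : R => v : R) by exact: Ckv_cst.
have c2 : Ckv k [set: R] (fun _ : R => - j%:R : R) by exact: Ckv_cst.
have s0 := Ckv_scale oT c1 (Ckv_add oT (IH j.+2) (Ckv_scale oT c2 (IH j.+1))).
apply: Ckv_eq s0 => // t _.
have -> : v = v *: (1 : R) by rewrite [RHS]mulr1.
have /derive_is_linear lf := df j t.
have := lf v 1 0; rewrite addr0 derive0 addr0 => ->.
have [_ ->] := is_derive_flat j t.
by rewrite [v *: 1]mulr1 scaleNr.
Qed.

End FlatFunction.

Section Bump.
Context {R : realType} {n : nat} (M : manifold R n).

#[local] Notation V := 'rV[R]_n.
#[local] Notation E := ('rV[R]_n * 'rV[R]_n)%type.
#[local] Notation bdom := (@pdom R (base M)).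
#[local] Notation bpar := (@param R (base M)).
#[local] Notation sdom := (@pdom R (slit M)).
#[local] Notation spar := (@param R (slit M)).
#[local] Notation bdir := (@dirder R (base M)).
#[local] Notation sdir := (@dirder R (slit M)).
#[local] Notation slitA := (atlas_slit M).
#[local] Notation baseA := (atlas_base M).

(** Composing the flat function with r^2 - |y - x|^2 gives a support inside
the Euclidean ball of radius r, hence inside the box. *)
Lemma box_bump (x : V) (r : R) : 0 < r ->
  exists phi : V -> R, [/\ smoothOn [set: V] phi, phi x = 1 &
    forall y, phi y != 0 -> forall k, y ord0 k \in `[x ord0 k - r, x ord0 k + r]].
Proof.
move=> r0; have oT : open [set: V] by exact: openT.
pose q (y : V) : R := r ^+ 2 - \sum_(k < n) (y ord0 k - x ord0 k) ^+ 2.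
have sq : smoothOn [set: V] q.
  apply: smoothOn_minus => //; first exact: smoothOn_cst.
  move=> m; apply: Ckv_sum => // k.
  have s1 : smoothOn [set: V] (fun y : V => y ord0 k - x ord0 k).
    apply: smoothOn_minus => //; last exact: smoothOn_cst.
    apply: (smoothOn_linear_map (l := @rVcoord R n k)) => //.
    exact: rVcoord_continuous.
  exact: (smoothOn_scale oT s1 s1 m).
have f0 : flat 0 (r ^+ 2) != 0.
  by rewrite /flat exprn_gt0// expr0 mul1r gt_eqF// expR_gt0.
exists (fun y => (flat 0 (r ^+ 2))^-1 * flat 0 (q y)); split.
- have sc : smoothOn [set: V] (fun _ : V => (flat 0 (r ^+ 2))^-1 : R).
    exact: smoothOn_cst.
  apply: (smoothOn_scale oT sc).
  apply: (smoothOn_comp (fV := findim_R R) (D' := [set: R]) (T := q)) => //.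
  exact: flat_smooth.
- rewrite /q big1 ?subr0 ?mulVf// => k _.
  by rewrite subrr expr2 mulr0.
- move=> y; rewrite mulf_eq0 negb_or => /andP[_].
  rewrite /flat; case: ifPn => [q0 _ k|_]; last by rewrite eqxx.
  have : (y ord0 k - x ord0 k) ^+ 2 < r ^+ 2.
    apply: le_lt_trans (_ : \sum_(k < n) (y ord0 k - x ord0 k) ^+ 2 < _).
      by rewrite (bigD1 k)//= lerDl sumr_ge0// => j _; exact: sqr_ge0.
    by rewrite -subr_gt0.
  rewrite -[ltLHS]real_normK ?num_real// ltr_pXn2r ?nnegrE ?(ltW r0)// ltr_distl.
  by rewrite in_itv/= => /andP[a b]; rewrite !ltW.
Qed.

(** The support is the image of a compact box; it is closed in M because M is
Hausdorff, so the extension by 0 outside the chart is smooth. *)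
Lemma chart_bump i x : bdom i x ->
  exists (chi : M -> R) (K : set M), [/\ closed K, K `<=` chart_dom i,
    forall p, ~ K p -> chi p = 0, chi (chart_param i x) = 1 &
    smoothOn (bdom i) (chi \o bpar i)].
Proof.
move=> ix; have oi := pdom_open baseA i.
have /nbhs_normP [e /= e0 eD] : nbhs x (bdom i) by exact: open_nbhs_nbhs.
pose r := e / 2; have r0 : 0 < r by rewrite divr_gt0.
have [phi [sphi phix phiB]] := box_bump x r0.
pose B : set V := [set y : V | forall k, `[x ord0 k - r, x ord0 k + r]%classic (y ord0 k)].
have cB : compact B.
  apply: (rV_compact (A := fun k => `[x ord0 k - r, x ord0 k + r]%classic)).
  by move=> k; exact: segment_compact.
have Bi : B `<=` bdom i.
  move=> y By; apply: eD; rewrite /ball_ /=.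
  apply: (@le_lt_trans _ _ r); last by rewrite /r ltr_pdivrMr// ltr_pMr// ltr1n.
  rewrite /Num.Def.normr/= mx_normrE; apply: bigmax_le; first exact: ltW.
  move=> [a k] _ /=; rewrite ord1 !mxE; have /= := By k.
  by rewrite in_itv/= distrC ler_distl.
have cK : closed (chart_param i @` B).
  apply: compact_closed; first exact: manifold_hausdorff.
  apply: continuous_compact => //; apply: continuous_in_subspaceT => y.
  rewrite inE => /Bi[p ip <-]; exact: param_continuous.
exists (fun p => if `[< chart_dom i p >] then phi (coord i p) else 0).
exists (chart_param i @` B); split=> //.
- by move=> _ [y /Bi[p ip <-] <-]; rewrite coordK.
- move=> p nK; case: asboolP => // ip; apply: contrapT => /eqP/phiB H.
  by apply: nK; exists (coord i p); [exact: H|rewrite coordK].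
- by case: ix phix => p ip <-; rewrite coordK//; case: asboolP.
- apply: (smoothOn_eq (f := phi)) => //; last exact: smoothOn_subset sphi.
  by move=> _ [p ip <-] /=; rewrite coordK//; case: asboolP.
Qed.

Lemma slit_in_chart i u : points (P := slit M) u -> chart_dom i u.1 ->
  exists2 z, sdom i z & spar i z = u.
Proof.
move=> [j [z [jz <-]]] /= ip.
have jz1 := slit_fst jz.
have iz1 : bdom i (coord i (chart_param j z.1)) by exists (chart_param j z.1).
have [|a Ea] := dirder_chart baseA z.2 iz1 jz1; first by rewrite /= coordK.
exists (coord i (chart_param j z.1), a); last first.
  by rewrite /= /TM_param/= coordK// Ea.
split=> /=; first by exists (chart_param j z.1).
apply/eqP => a0; case: jz => _ /eqP; apply.
by apply: (dirder_inj baseA jz1); rewrite Ea a0 !dirder0.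
Qed.

(** Every point outside K has a neighbourhood on which g vanishes. *)
Lemma smooth_at_zero (g : M * der (base M) -> R) (K : set M) u :
  closed K -> ~ K u.1 -> (forall w, points (P := slit M) w -> ~ K w.1 -> g w = 0) ->
  points (P := slit M) u -> smooth_at (P := slit M) u g.
Proof.
move=> cK nK g0 [j [z [jz Eu]]].
rewrite -{}Eu in nK *.
pose O : set E := sdom j `&` [set z : E | (bdom j `&` chart_param j @^-1` ~` K) z.1].
have oO : open O.
  apply: openI; first exact: sdom_open.
  apply: open_fst; apply: open_setI_preimage.
  - exact: pdom_open baseA j.
  - exact: closed_openC.
  - by move=> _ [p jp <-]; exact: param_continuous.
apply: (smooth_at_chart slitA oO) => //.
  by split=> //; split=> //=; exact: slit_fst jz.
apply: (smoothOn_eq (f := fun _ => 0)) => //; last exact: smoothOn_cst.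
by move=> w [jw [_ nKw]] /=; rewrite g0//; exact: sdom_points.
Qed.

(** The constant field w of the chart, multiplied by a bump function of the
base point that equals 1 at the foot of z. *)
Lemma smooth_vfield_through i z (w : E) : sdom i z ->
  exists (X : vfield (slit M)) xi,
    [/\ smooth_vfield X, vrep i X xi & xi z = w].
Proof.
move=> iz; have [chi [K [cK Ki chi0 chi1 schi]]] := chart_bump (slit_fst iz).
have oi := @sdom_open _ _ M i.
pose X : vfield (slit M) := fun u => chi u.1 *: sdir i (@chart_inv R (slit M) i u) w.
pose xi (y : E) : E := chi (chart_param i y.1) *: w.
have rX : vrep i X xi.
  split=> [|y iy].
    apply: smoothOn_scale => //; last exact: smoothOn_cst.
    apply: (smoothOn_comp_fst (A := bdom i) (f := chi \o bpar i)) => //.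
    by move=> y; exact: slit_fst.
  by rewrite /X (chart_invK slitA iy) -(dirderZ _ _ iy).
exists X, xi; split=> //; last by rewrite /xi chi1 scale1r.
move=> u pu; case: (pselect (chart_dom i u.1)) => iu.
  have [y iy <-] := slit_in_chart pu iu; split.
    by rewrite (rX.2 _ iy); exact: dirder_tangent.
  by move=> f; exact: (smooth_at_vrep slitA rX).
have nK : ~ K u.1 by move/Ki.
split.
  case: pu nK => [j [y [jy <-]]] nK.
  rewrite /X chi0// scale0r -(dirder0 jy).
  exact: dirder_tangent.
move=> f sf; apply: (smooth_at_zero cK nK) => // v _ nKv.
by rewrite /X chi0// scale0r.
Qed.

Lemma smooth_pifield_through i z (w : V) : sdom i z ->
  exists (Y : pifield M) a, [/\ smooth_pifield Y, prep i Y a & a z = w].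
Proof.
move=> iz; have [X [xi [sX rX Ez]]] := smooth_vfield_through (w, 0) iz.
exists (rhof X), (fun z => (xi z).1); split; last by rewrite Ez.
  apply: smooth_pifield_charts => j; eexists; apply: prep_rho; exact: (vrep_exists slitA).
exact: prep_rho.
Qed.

End Bump.

(** * The canonical spray of a Finsler function *)
Section Spray.
Context {R : realType} {n : nat} (M : manifold R n).

#[local] Notation V := 'rV[R]_n.
#[local] Notation E := ('rV[R]_n * 'rV[R]_n)%type.
#[local] Notation sdom := (@pdom R (slit M)).
#[local] Notation spar := (@param R (slit M)).
#[local] Notation bdir := (@dirder R (base M)).
#[local] Notation sdir := (@dirder R (slit M)).
#[local] Notation slitA := (atlas_slit M).
#[local] Notation baseA := (atlas_base M).

Lemma slit_vrep_exists i (X : vfield (slit M)) : smooth_vfield X ->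
  exists xi, vrep i X xi.
Proof. by move=> sX; eexists; exact: (vrep_exists slitA). Qed.

Lemma smooth_at_smoothOn i (f : M * der (base M) -> R) :
  (forall u, points (P := slit M) u -> smooth_at (P := slit M) u f) ->
  smoothOn (sdom i) (f \o spar i).
Proof.
move=> sf; apply: (smoothOn_chart slitA) => z iz; apply: sf; exact: sdom_points.
Qed.

Lemma euler_field_smooth (D : set E) : open D ->
  smoothOn D (fun y : E => (0, y.2) : E).
Proof.
move=> oD; apply: smoothOn_pair => //; [exact: smoothOn_cst|exact: smoothOn_snd].
Qed.

Lemma pd_euler_field (D : set E) (z w : E) : open D -> D z ->
  pd (fun y : E => (0, y.2) : E) z w = (0, w.2).
Proof.
move=> oD Dz; have s0 : smoothOn D (fun _ : E => 0 : V) by exact: smoothOn_cst.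
by rewrite (pd_pair _ s0 (smoothOn_snd oD) Dz) pd_cst pd_snd.
Qed.

(** Euler's identity: differentiate t |-> f (x, t y) at t = 1. *)
Lemma euler_homogeneous i (f : M * der (base M) -> R) (k : nat) z :
  smoothOn (sdom i) (f \o spar i) ->
  (forall u, points (P := slit M) u -> forall c : R, 0 < c ->
     f (u.1, c *: u.2) = c ^+ k * f u) ->
  sdom i z -> pd (f \o spar i) z (0, z.2) = k%:R * (f \o spar i) z.
Proof.
move=> sf hf iz; have oi := @sdom_open _ _ M i.
pose T (t : R) : E := (z.1, t *: z.2).
have oR : open [set t : R | 0 < t] by exact: open_gt.
have s1 : smoothOn [set t : R | 0 < t] (fun _ : R => z.1) by exact: smoothOn_cst.
have s2 : smoothOn [set t : R | 0 < t] (fun t : R => t *: z.2).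
  by apply: smoothOn_scale => //; [exact: smoothOn_id|exact: smoothOn_cst].
have sT : smoothOn [set t : R | 0 < t] T by exact: smoothOn_pair.
have T1 : T 1 = z by rewrite /T scale1r; case: (z).
have dT : pd T 1 1 = (0, z.2).
  rewrite (pd_pair _ s1 s2)//= pd_cst.
  have sid : smoothOn [set t : R | 0 < t] (@id R) by exact: smoothOn_id.
  have sc : smoothOn [set t : R | 0 < t] (fun _ : R => z.2) by exact: smoothOn_cst.
  by rewrite (pd_scale _ sid sc)//= pd_cst pd_id scaler0 add0r scale1r.
have iT : sdom i (T 1) by rewrite T1.
have := @pd_comp _ _ _ _ _ (sdom i) (f \o spar i) T 1 1 sT sf ltr01 iT.
rewrite dT T1 => <-.
have E1 (t : R) : 0 < t -> (f \o spar i) (T t) = t ^+ k * (f \o spar i) z.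
  move=> t0; rewrite -(hf (spar i z)) //; last exact: sdom_points.
  by rewrite /= /TM_param/= (dirderZ _ _ (slit_fst iz)).
rewrite (@pd_eq _ _ _ oR _ _ (fun t : R => t ^+ k * (f \o spar i) z) 1 1 ltr01 E1).
rewrite pdE.
have -> : (fun t : R => t ^+ k * (f \o spar i) z) =
   ((f \o spar i) z) \*: (fun t : R => t ^+ k).
  by apply: funext => t; rewrite /= mulrC.
rewrite deriveZ; last exact: exprn_derivable.
by rewrite exp_derive expr1n /GRing.scale /= !mulr1 mulrC.
Qed.

Lemma d_J_chart i f X xi z :
  (forall u, points (P := slit M) u -> smooth_at (P := slit M) u f) ->
  vrep i X xi -> sdom i z -> d_J f X (spar i z) = pd (f \o spar i) z (0, (xi z).1).
Proof.
move=> sf rX iz; rewrite /d_J (vrep_apply (vrep_J rX))//.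
apply: sf; exact: sdom_points.
Qed.

Lemma smooth_at_d_J i f X xi z :
  (forall u, points (P := slit M) u -> smooth_at (P := slit M) u f) ->
  vrep i X xi -> sdom i z -> smooth_at (P := slit M) (spar i z) (d_J f X).
Proof.
move=> sf rX iz; apply: (smooth_at_vrep slitA (vrep_J rX)) => //.
apply: sf; exact: sdom_points.
Qed.

(** The terms containing derivatives of the fields cancel against the bracket:
the two-form is tensorial and only depends on the second derivatives of f. *)
Lemma ext_d_J_chart i f X Y (xi eta : E -> E) z :
  (forall u, points (P := slit M) u -> smooth_at (P := slit M) u f) ->
  vrep (P := slit M) i X xi -> vrep (P := slit M) i Y eta -> sdom i z ->
  ext_d (d_J f) X Y (spar i z) =
    pd (fun y => pd (f \o spar i) y (0, (eta z).1)) z (xi z) -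
    pd (fun y => pd (f \o spar i) y (0, (xi z).1)) z (eta z).
Proof.
move=> sf rX rY iz; have oi := @sdom_open _ _ M i.
have sfi : smoothOn (sdom i) (f \o spar i) by exact: smooth_at_smoothOn.
have key X1 Y1 (xi1 eta1 : E -> E) : vrep (P := slit M) i X1 xi1 ->
    vrep (P := slit M) i Y1 eta1 ->
    X1 (spar i z) (d_J f Y1) =
    pd (fun y => pd (f \o spar i) y (0, (eta1 z).1)) z (xi1 z) +
    pd (f \o spar i) z (0, (pd eta1 z (xi1 z)).1).
  move=> r1 r2; rewrite (vrep_apply r1)//; last exact: smooth_at_d_J r2 iz.
  have s1 : smoothOn (sdom i) (fun y => (eta1 y).1).
    by apply: (smoothOn_linear_comp (l := fst)) => //; [exact: prod_fst_continuous|exact: r2.1].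
  have s0 : smoothOn (sdom i) (fun _ : E => 0 : V) by exact: smoothOn_cst.
  have s2 : smoothOn (sdom i) (fun y => (0, (eta1 y).1) : E) by exact: smoothOn_pair.
  rewrite (@pd_eq _ _ _ oi _ _ (fun y => pd (f \o spar i) y (0, (eta1 y).1)))//.
    rewrite (pd_pd oi)// (pd_pair _ s0 s1)// pd_cst.
    by rewrite (pd_linear_comp (l := fst) _ _ r2.1)//; exact: prod_fst_continuous.
  by move=> y iy; rewrite /= (d_J_chart sf r2 iy).
rewrite /ext_d (key _ _ _ _ rX rY) (key _ _ _ _ rY rX).
rewrite (d_J_chart sf (vrep_bracket slitA rX rY) iz).
have -> : (0, (pd eta z (xi z) - pd xi z (eta z)).1) =
   (0, (pd eta z (xi z)).1) - (0, (pd xi z (eta z)).1) :> E.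
  by rewrite -[RHS]/(0 - 0, (pd eta z (xi z)).1 - (pd xi z (eta z)).1) subr0.
by rewrite (pdBr sfi iz) opprD addrACA addrK.
Qed.


Section SprayOfFinsler.
Variables (L : M * der (base M) -> R) (hL : finsler L).

Lemma energy_smooth u : points (P := slit M) u ->
  smooth_at (P := slit M) u (energy L).
Proof.
case=> i [z [iz <-]].
have sL : smoothOn (sdom i) (L \o spar i).
  by apply: smooth_at_smoothOn; exact: finsler_smooth.
have oi := @sdom_open _ _ M i.
apply: (smooth_at_chart slitA oi) => //.
have s2 : smoothOn (sdom i) (fun _ => 2^-1 : R) by exact: smoothOn_cst.
exact: (smoothOn_scale oi s2 (smoothOn_scale oi sL sL)).
Qed.

Section Chart.
Variable i : pix (slit M).
#[local] Notation D := (sdom i).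
#[local] Notation e := (energy L \o spar i).

Let oD : open D := @sdom_open _ _ M i.

Let se : smoothOn D e.
Proof. apply: smooth_at_smoothOn; exact: energy_smooth. Qed.

Lemma slit_tbundle u : points (P := slit M) u -> points (P := tbundle M) u.
Proof. by move=> [j [z [[jz _] <-]]]; exists j, z. Qed.

Lemma euler_energy z : D z -> pd e z (0, z.2) = 2%:R * e z.
Proof.
apply: euler_homogeneous; first exact: se.
move=> u pu c c0; rewrite /energy (finsler_homogeneous hL (slit_tbundle pu) c0).
by rewrite exprMn mulrCA.
Qed.

(** The differential of Euler's identity for the energy. *)
Lemma energy_hessian_euler z w : D z ->
  pd (fun y => pd e y (0, z.2)) z w + pd e z (0, w.2) = 2%:R * pd e z w.
Proof.
move=> Dz; have sE := euler_field_smooth oD.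
have := pd_pd oD w Dz se sE; rewrite (pd_euler_field _ oD Dz) /= => <-.
rewrite (@pd_eq _ _ _ oD _ _ (fun y => 2%:R *: e y))//; last first.
  by move=> y Dy; exact: euler_energy.
by rewrite (pd_scalec _ _ se).
Qed.

Lemma energy_hessian_sym z v w : D z ->
  pd (fun y => pd e y v) z w = pd (fun y => pd e y w) z v.
Proof. by move=> Dz; apply: (@pd_sym _ _ _ oD _ (findim_R R)) => //; exact: se. Qed.

(** A vertical vector in the kernel of the vertical Hessian of the energy lies
in the kernel of dd_JE. *)
Lemma energy_nondegenerate z v : D z ->
  (forall b, pd (fun y => pd e y (0, b)) z (0, v) = 0) -> v = 0.
Proof.
move=> Dz H; have [X [xi [sX rX xz]]] := smooth_vfield_through (0, v) Dz.
have X0 : X (spar i z) = 0.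
  apply: (finsler_nondegenerate hL (sdom_points Dz) sX) => Y sY.
  have [eta rY] := slit_vrep_exists i sY.
  rewrite (ext_d_J_chart energy_smooth rX rY Dz) xz H sub0r /=.
  rewrite (@pd_eq _ _ _ oD _ _ (fun _ => 0))//; first by rewrite pd_cst oppr0.
  by move=> y Dy; rewrite (pd0r se Dy).
move: X0; rewrite (rX.2 _ Dz) xz -(dirder0 Dz) => /(dirder_inj slitA Dz).
by case.
Qed.

Variables (G : vfield (slit M)) (hG : canonical_spray L G).

(** Any vector w is a value of a global field, so the defining equation of the
spray holds for each w separately. *)
Lemma spray_equation gam z w : vrep i G gam -> D z ->
  pd (fun y => pd e y (0, w.1)) z (gam z) -
  pd (fun y => pd e y (0, (gam z).1)) z w = - pd e z w.
Proof.
move=> rG Dz; have [X [xi [sX rX xz]]] := smooth_vfield_through w Dz.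
have := hG.2 X sX _ (sdom_points Dz).
rewrite (ext_d_J_chart energy_smooth rG rX Dz) xz => ->.
by rewrite (vrep_apply rX Dz) ?xz//; apply: energy_smooth; exact: sdom_points.
Qed.

(** On vertical vectors the spray equation says that the vertical Hessian sends
the base component of the spray to the vertical differential of the energy;
by Euler's identity it sends y there too. *)
Lemma spray_fst gam z : vrep i G gam -> D z -> (gam z).1 = z.2.
Proof.
move=> rG Dz; apply/eqP; rewrite -subr_eq0; apply/eqP.
apply: (energy_nondegenerate Dz) => b.
rewrite energy_hessian_sym//.
have sp w : smoothOn D (fun y => pd e y w) by apply: smoothOn_pd_const; exact: se.
rewrite (@pd_eq _ _ _ oD _ _ (fun y => pd e y (0, (gam z).1) - pd e y (0, z.2)))//; last first.
  move=> y Dy; rewrite -(pdBr se Dy).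
  by rewrite -[(0, (gam z).1) - _]/(0 - 0, (gam z).1 - z.2) subr0.
rewrite (pd_sub _ (sp _) (sp _) Dz).
have := spray_equation (0, b) rG Dz => /=.
rewrite (@pd_eq _ _ _ oD _ _ (fun _ => 0))//; last first.
  by move=> y Dy; rewrite (pd0r se Dy).
rewrite pd_cst sub0r => /oppr_inj ->.
have := energy_hessian_euler (0, b) Dz => /=.
by rewrite mulr_natl mulr2n => /addIr ->; rewrite subrr.
Qed.

(** The vertical component s is determined by an equation with homogeneous
coefficients.  Differentiating that equation along the Euler field (0, y)
shows that the vertical Hessian annihilates ds(0, y) - 2 s. *)
Lemma spray_homogeneous gam z : vrep i G gam -> D z ->
  pd (fun y => (gam y).2) z (0, z.2) = 2%:R *: (gam z).2.
Proof.
move=> rG Dz; pose s y := (gam y).2.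
have gamE y : D y -> gam y = (y.2, s y).
  by move=> Dy; rewrite -(spray_fst rG Dy) /s; case: (gam y).
have ss : smoothOn D s.
  by apply: (smoothOn_linear_comp (l := snd)) => //; [exact: prod_snd_continuous|exact: rG.1].
have sp w : smoothOn D (fun y => pd e y w) by apply: smoothOn_pd_const; exact: se.
have ssnd : smoothOn D (snd : E -> V) by exact: smoothOn_snd.
have sys : smoothOn D (fun y : E => (y.2, s y) : E) by exact: smoothOn_pair.
(* The spray equation on horizontal vectors, simplified by Euler's identity. *)
have eq1 a y : D y ->
    pd (fun y => pd e y (0, a)) y (y.2, s y) = pd e y (a, 0).
  move=> Dy; have := spray_equation (a, 0) rG Dy; rewrite gamE//=.
  have := energy_hessian_euler (a, 0) Dy; rewrite /= (pd0r se Dy) addr0 => ->.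
  by move/eqP; rewrite subr_eq mulr_natl mulr2n addKr => /eqP.
have hp a y : D y -> pd (fun y => pd e y (0, a)) y (0, y.2) = pd e y (0, a).
  move=> Dy; rewrite energy_hessian_sym//; have := energy_hessian_euler (0, a) Dy => /=.
  by rewrite mulr_natl mulr2n => /addIr.
have hq a : pd (fun y => pd e y (a, 0)) z (0, z.2) = 2%:R * pd e z (a, 0).
  rewrite energy_hessian_sym//; have := energy_hessian_euler (a, 0) Dz => /=.
  by rewrite (pd0r se Dz) addr0.
apply/eqP; rewrite -subr_eq0; apply/eqP; apply: (energy_nondegenerate Dz) => a.
(* dp is the differential of the identity saying that p is homogeneous of
   degree 1; d1 is the derivative of eq1 along the Euler field. *)
pose p y := pd e y (0, a).
have sEu := euler_field_smooth oD.
have sC w : smoothOn D (fun y => pd p y w) by apply: smoothOn_pd_const; exact: sp.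
have dp w : pd (fun y => pd p y (0, z.2)) z w + pd p z (0, w.2) = pd p z w.
  have := pd_pd oD w Dz (sp (0, a)) sEu; rewrite (pd_euler_field _ oD Dz) /= => <-.
  by apply: (pd_eq oD) => // y Dy; exact: hp.
have d1 : pd (fun y => pd p y (y.2, s y)) z (0, z.2) = 2%:R * pd p z (z.2, s z).
  rewrite (@pd_eq _ _ _ oD _ _ (fun y => pd e y (a, 0)))//.
    by rewrite hq eq1.
  by move=> y Dy; exact: eq1.
move: d1; rewrite (pd_pd oD _ Dz (sp (0, a)) sys).
rewrite (pd_pair _ ssnd ss Dz) pd_snd /=.
rewrite (@pd_sym _ _ _ oD _ (findim_R R) p z _ _ Dz (sp (0, a))).
have /= /esym/eqP := dp (z.2, s z); rewrite -subr_eq => /eqP <-.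
set t := pd s z (0, z.2) => d1.
have lp := pdDr (sp (0, a)) Dz.
have -> : (0, t - 2%:R *: s z) = (z.2, s z) - (0, s z) + (z.2, t) - 2%:R *: (z.2, s z) :> E.
  apply: (congr2 pair).
    by rewrite /= subr0 scaler_nat mulr2n subrr.
  by rewrite /= subrr add0r.
by rewrite (pdBr (sp _) Dz) (pdDr (sp _) Dz) (pdBr (sp _) Dz) (pdZr (sp _) Dz) d1 subrr.
Qed.

Lemma spray_coefficients : exists g : E -> V, [/\ smoothOn D g,
  forall z, D z -> pd g z (0, z.2) = 2%:R *: g z &
  vrep i G (fun z => (z.2, - (2%:R *: g z)))].
Proof.
have [gam rG] := slit_vrep_exists i hG.1.
have ss : smoothOn D (fun y => (gam y).2).
  by apply: (smoothOn_linear_comp (l := snd)) => //; [exact: prod_snd_continuous|exact: rG.1].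
pose g y := (- 2%:R^-1) *: (gam y).2.
have sg : smoothOn D g 
  by apply: smoothOn_scale => //; exact: smoothOn_cst.
exists g; split; [exact: sg|move=> z Dz|].
  rewrite /g (pd_scalec _ _ ss Dz) (spray_homogeneous rG Dz).
  by rewrite !scalerA mulrC.
apply: (vrep_ext _ rG) => z Dz; rewrite [LHS]surjective_pairing (spray_fst rG Dz).
by rewrite /g scalerA mulrN mulfV ?pnatr_eq0// scaleN1r opprK.
Qed.

End Chart.
End SprayOfFinsler.
End Spray.

(** * Connection and curvature coefficients of a spray *)
Section LinearMaps.
Variables (R : realType) (U W : normedModType R) (h : U -> W).
Hypothesis lh : linear h.
Lemma linear_map0 : h 0 = 0.
Proof.
by have := lh 1 0 0; rewrite !scale1r addr0 -{1}(addr0 (h 0)) => /addrI.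
Qed.
Lemma linear_mapD a b : h (a + b) = h a + h b.
Proof. by have := lh 1 a b; rewrite !scale1r. Qed.
Lemma linear_mapZ k a : h (k *: a) = k *: h a.
Proof. by have := lh k a 0; rewrite !addr0 linear_map0 addr0. Qed.
Lemma linear_mapN a : h (- a) = - h a.
Proof. by rewrite -scaleN1r linear_mapZ scaleN1r. Qed.
Lemma linear_mapB a b : h (a - b) = h a - h b.
Proof. by rewrite linear_mapD linear_mapN. Qed.
End LinearMaps.

Section SprayCalculus.
Context {R : realType} {n : nat}.
#[local] Notation V := 'rV[R]_n.
#[local] Notation E := ('rV[R]_n * 'rV[R]_n)%type.

(** The nonlinear connection, the Berwald connection coefficients and the
horizontal lift determined by the spray (y, - 2 g). *)
Definition Ncoef (g : E -> V) (z : E) (a : V) : V := pd g z (0, a).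
Definition Bcoef (g : E -> V) (z : E) (a b : V) : V :=
  pd (fun y => Ncoef g y a) z (0, b).
Definition hlift (g : E -> V) (z : E) (a : V) : E := (a, - Ncoef g z a).

Lemma vert_linear k (a b : V) : (0, k *: a + b) = k *: (0, a) + (0, b) :> E.
Proof. by rewrite -[RHS]/(k *: 0 + 0, k *: a + b) scaler0 addr0. Qed.

Section Coefficients.
Variables (D : set E) (g : E -> V).
Hypotheses (oD : open D) (sg : smoothOn D g).

Lemma Ncoef_linear z : D z -> linear (Ncoef g z).
Proof. by move=> Dz k a b; rewrite /Ncoef vert_linear (pd_linear sg Dz). Qed.

Lemma smooth_vert (a : E -> V) : smoothOn D a -> smoothOn D (fun z => (0, a z) : E).
Proof. by move=> sa; apply: smoothOn_pair => //; exact: smoothOn_cst. Qed.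

Lemma smooth_N (a : E -> V) : smoothOn D a -> smoothOn D (fun z => Ncoef g z (a z)).
Proof. by move=> sa; apply: smoothOn_pd => //; exact: smooth_vert. Qed.

Lemma smooth_N_const a : smoothOn D (fun z => Ncoef g z a).
Proof. exact: smoothOn_pd_const. Qed.

Lemma pd_N (a : E -> V) z w : D z -> smoothOn D a ->
  pd (fun y => Ncoef g y (a y)) z w
  = pd (fun y => Ncoef g y (a z)) z w + Ncoef g z (pd a z w).
Proof.
move=> Dz sa; apply: (pd_family oD (F := Ncoef g)) => //.
  exact: Ncoef_linear.
exact: smooth_N_const.
Qed.

Lemma Bcoef_sym z a b : D z -> Bcoef g z a b = Bcoef g z b a.
Proof. by move=> Dz; apply: (@pd_sym _ _ _ oD _ (findim_rV n)). Qed.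

Lemma Bcoef_linearr z a : D z -> linear (Bcoef g z a).
Proof.
by move=> Dz k b c; rewrite /Bcoef vert_linear (pd_linear (smooth_N_const a) Dz).
Qed.

Lemma Bcoef_linearl z b : D z -> linear (fun a => Bcoef g z a b).
Proof.
move=> Dz k a c; rewrite (Bcoef_sym _ _ Dz) (Bcoef_linearr b Dz).
by rewrite (Bcoef_sym a b Dz) (Bcoef_sym c b Dz).
Qed.

Lemma smooth_B_const a b : smoothOn D (fun z => Bcoef g z a b).
Proof. apply: smoothOn_pd_const; exact: smooth_N_const. Qed.

Lemma smooth_B_constl a (b : E -> V) : smoothOn D b ->
  smoothOn D (fun z => Bcoef g z a (b z)).
Proof.
move=> sb; apply: (smoothOn_family (F := fun z v => Bcoef g z a v)) => //.
  by move=> z Dz; exact: Bcoef_linearr.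
exact: smooth_B_const.
Qed.

Lemma smooth_B (a b : E -> V) : smoothOn D a -> smoothOn D b ->
  smoothOn D (fun z => Bcoef g z (a z) (b z)).
Proof.
move=> sa sb; apply: (smoothOn_family (F := fun z v => Bcoef g z v (b z))) => //.
  by move=> z Dz; exact: Bcoef_linearl.
by move=> v; exact: smooth_B_constl.
Qed.

Lemma pd_B (a b : E -> V) z w : D z -> smoothOn D a -> smoothOn D b ->
  pd (fun y => Bcoef g y (a y) (b y)) z w
  = pd (fun y => Bcoef g y (a z) (b z)) z w
    + Bcoef g z (a z) (pd b z w) + Bcoef g z (pd a z w) (b z).
Proof.
move=> Dz sa sb; rewrite (pd_family oD (F := fun y v => Bcoef g y v (b y)))//.
- congr (_ + _); apply: (pd_family oD (F := fun y => Bcoef g y (a z))) => //.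
    by move=> y Dy; exact: Bcoef_linearr.
  exact: smooth_B_const.
- by move=> y Dy; exact: Bcoef_linearl.
- by move=> v; exact: smooth_B_constl.
Qed.

Lemma hlift_linear z : D z -> linear (hlift g z).
Proof.
move=> Dz k a b; rewrite /hlift (Ncoef_linear Dz).
by rewrite -[RHS]/(k *: a + b, k *: (- Ncoef g z a) - Ncoef g z b) scalerN opprD.
Qed.

Lemma smooth_hlift (a : E -> V) : smoothOn D a ->
  smoothOn D (fun z => hlift g z (a z)).
Proof.
by move=> sa; apply: smoothOn_pair => //; apply: smoothOn_opp => //; exact: smooth_N.
Qed.

Lemma pd_hlift_fst (a : E -> V) z w : D z -> smoothOn D a ->
  (pd (fun y => hlift g y (a y)) z w).1 = pd a z w.
Proof.
move=> Dz sa; have sN := smoothOn_opp oD (smooth_N sa).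
by rewrite (pd_pair _ sa sN Dz).
Qed.

Lemma pd_hlift_snd (a : E -> V) z w : D z -> smoothOn D a ->
  (pd (fun y => hlift g y (a y)) z w).2
  = - (pd (fun y => Ncoef g y (a z)) z w + Ncoef g z (pd a z w)).
Proof.
move=> Dz sa; have sN := smooth_N sa.
by rewrite (pd_pair _ sa (smoothOn_opp oD sN) Dz)/= (pd_opp oD _ sN Dz) pd_N.
Qed.

Lemma pd_vert (a : E -> V) z w : D z -> smoothOn D a ->
  pd (fun y => (0, a y) : E) z w = (0, pd a z w).
Proof.
move=> Dz sa; have s0 : smoothOn D (fun _ : E => 0 : V) by exact: smoothOn_cst.
by rewrite (pd_pair _ s0 sa Dz) pd_cst.
Qed.

(** The h-curvature R(a, b) c and the torsion R(a, b) y in a chart. *)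
Definition curv_coef z a b c : V :=
  pd (fun y => Bcoef g y a c) z (hlift g z b)
  - pd (fun y => Bcoef g y b c) z (hlift g z a)
  + (Bcoef g z b (Bcoef g z a c) - Bcoef g z a (Bcoef g z b c)).

Definition curv_hat z a b : V :=
  pd (fun y => Ncoef g y a) z (hlift g z b)
  - pd (fun y => Ncoef g y b) z (hlift g z a).

(** Differentiating the direction (b, - N b) of the lift produces the quadratic
terms in B. *)
Lemma pd_curv_hat z a b c : D z ->
  pd (fun y => curv_hat y a b) z (0, c) = curv_coef z a b c.
Proof.
move=> Dz; pose dN a b := fun y => pd (fun x => Ncoef g x a) y (hlift g y b).
have sc (v : V) : smoothOn D (fun _ : E => v) by exact: smoothOn_cst.
have sh v : smoothOn D (fun y => hlift g y v) := smooth_hlift (sc v).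
have sdN a1 b1 : smoothOn D (dN a1 b1).
  by apply: smoothOn_pd => //; exact: smooth_N_const.
rewrite -[X in pd X]/(fun y => dN a b y - dN b a y) (pd_sub _ (sdN _ _) (sdN _ _) Dz).
have E1 a1 b1 : pd (dN a1 b1) z (0, c) =
    pd (fun y => Bcoef g y a1 c) z (hlift g z b1) - Bcoef g z a1 (Bcoef g z b1 c).
  rewrite (pd_pd oD _ Dz (smooth_N_const a1) (sh b1)).
  rewrite (@pd_sym _ _ _ oD _ (findim_rV n) (fun y => Ncoef g y a1) z _ _ Dz (smooth_N_const a1)).
  congr (_ + _).
  have -> : pd (fun y => hlift g y b1) z (0, c) = (0, - Bcoef g z b1 c).
    rewrite [LHS]surjective_pairing (pd_hlift_fst _ Dz (sc b1)) pd_cst.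
    rewrite (pd_hlift_snd _ Dz (sc b1)) pd_cst.
    by rewrite (linear_map0 (Ncoef_linear Dz)) addr0.
  exact: (linear_mapN (Bcoef_linearr a1 Dz)).
rewrite !E1 /curv_coef opprB addrACA [RHS]addrACA; congr (_ + _).
exact: addrC.
Qed.

Section Homogeneous.
Hypothesis hg : forall z, D z -> pd g z (0, z.2) = 2%:R *: g z.

(** N is homogeneous of degree 1, being a vertical derivative of g. *)
Lemma Ncoef_homogeneous z a : D z -> Bcoef g z a z.2 = Ncoef g z a.
Proof.
move=> Dz; rewrite (Bcoef_sym _ _ Dz).
have sE := euler_field_smooth oD.
have := @pd_pd _ _ _ oD _ (@findim_prod R _ _ (findim_rV n) (findim_rV n)) _ _ z (0, a) Dz sg sE.
rewrite (pd_euler_field _ oD Dz) /=.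
rewrite (@pd_eq _ _ _ oD _ _ (fun y => 2%:R *: g y) _ _ Dz hg).
rewrite (pd_scalec _ _ sg Dz) scaler_nat mulr2n => /addIr /esym.
exact.
Qed.

(** Writing N a as B a y, the derivative of the factor y along a lift cancels
the quadratic terms of the curvature. *)
Lemma curv_coef_hat z a b : D z -> curv_coef z a b z.2 = curv_hat z a b.
Proof.
move=> Dz.
have sc (v : V) : smoothOn D (fun _ : E => v) by exact: smoothOn_cst.
have ssnd : smoothOn D (snd : E -> V) by exact: smoothOn_snd.
have E1 a1 b1 : pd (fun y => Ncoef g y a1) z (hlift g z b1) =
   pd (fun y => Bcoef g y a1 z.2) z (hlift g z b1) - Bcoef g z a1 (Ncoef g z b1).
  rewrite (@pd_eq _ _ _ oD _ _ (fun y => Bcoef g y a1 y.2) _ _ Dz); last first.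
    by move=> y Dy; rewrite Ncoef_homogeneous.
  rewrite (pd_B _ Dz (sc a1) ssnd) pd_cst pd_snd /=.
  by rewrite (linear_map0 (Bcoef_linearl _ Dz)) addr0 (linear_mapN (Bcoef_linearr _ Dz)).
rewrite /curv_hat !E1 /curv_coef !Ncoef_homogeneous// opprB addrACA [RHS]addrACA.
by congr (_ + _); exact: addrC.
Qed.

End Homogeneous.

End Coefficients.
End SprayCalculus.

(** * The Berwald connection in a chart *)
Section BerwaldChart.
Context {R : realType} {n : nat} (M : manifold R n).

#[local] Notation V := 'rV[R]_n.
#[local] Notation E := ('rV[R]_n * 'rV[R]_n)%type.
#[local] Notation sdom := (@pdom R (slit M)).
#[local] Notation spar := (@param R (slit M)).
#[local] Notation bdir := (@dirder R (base M)).
#[local] Notation sdir := (@dirder R (slit M)).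
#[local] Notation slitA := (atlas_slit M).
#[local] Notation baseA := (atlas_base M).
#[local] Notation vrep := (@vrep R (slit M)).

Variables (G : vfield (slit M)) (i : pix (slit M)) (g : E -> V).
#[local] Notation D := (sdom i).
#[local] Notation N := (Ncoef g).
#[local] Notation B := (Bcoef g).
#[local] Notation hl := (hlift g).
Hypothesis sg : smoothOn D g.
Hypothesis rG : vrep i G (fun z => (z.2, - (2%:R *: g z))).
Let oD : open D := @sdom_open _ _ M i.

Lemma smoothOn_fst_comp (xi : E -> E) : smoothOn D xi -> smoothOn D (fun z => (xi z).1).
Proof. exact: (smoothOn_linear_comp (l := fst) oD (@prod_fst_continuous R V V)). Qed.

Lemma smoothOn_snd_comp (xi : E -> E) : smoothOn D xi -> smoothOn D (fun z => (xi z).2).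
Proof. exact: (smoothOn_linear_comp (l := snd) oD (@prod_snd_continuous R V V)). Qed.

Lemma pd_fst_comp (xi : E -> E) z w : smoothOn D xi -> D z ->
  pd (fun y => (xi y).1) z w = (pd xi z w).1.
Proof. exact: (pd_linear_comp (l := fst) _ (@prod_fst_continuous R V V)). Qed.

Lemma slit_vrep_bracket X Y (xi eta : E -> E) : vrep i X xi -> vrep i Y eta ->
  vrep i (bracket X Y) (fun z => pd eta z (xi z) - pd xi z (eta z)).
Proof. by move=> rX rY; exact: (vrep_bracket slitA rX rY). Qed.

Lemma half_double (a : V) : 2^-1 *: (a + a) = a.
Proof.
by rewrite -mulr2n -[a *+ 2]scaler_nat scalerA mulVf ?pnatr_eq0// scale1r.
Qed.

Lemma vrep_barthel X (xi : E -> E) : vrep i X xi ->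
  vrep i (barthel G X) (fun z => ((xi z).1, - (2%:R *: N z (xi z).1) - (xi z).2)).
Proof.
move=> rX; have rJ := vrep_J rX.
have sx1 := smoothOn_fst_comp rX.1.
have ssnd : smoothOn D (snd : E -> V) by exact: smoothOn_snd.
have s2g : smoothOn D (fun z => 2%:R *: g z).
  by apply: smoothOn_scale => //; exact: smoothOn_cst.
have sm2g : smoothOn D (fun z => - (2%:R *: g z)) by exact: smoothOn_opp.
have dG z w : D z -> pd (fun z : E => (z.2, - (2%:R *: g z)) : E) z w =
    (w.2, - (2%:R *: pd g z w)).
  move=> Dz; rewrite (pd_pair _ ssnd sm2g Dz) pd_snd.
  by rewrite (pd_opp oD _ s2g Dz) (pd_scalec _ _ sg Dz).
apply: vrep_ext (vrep_sub (slit_vrep_bracket rJ rG)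
  (vrep_J (slit_vrep_bracket rX rG))) => z Dz.
rewrite !(dG _ _ Dz) (pd_vert _ Dz sx1) (pd_fst_comp _ rX.1 Dz) /=.
set d := (pd xi z _).1.
rewrite -[LHS]/((xi z).1 - 0 - 0, - (2%:R *: N z (xi z).1) - d - ((xi z).2 - d)).
by rewrite !subr0 opprB addrA subrK.
Qed.

Lemma vrep_hor X (xi : E -> E) : vrep i X xi ->
  vrep i (hor G X) (fun z => hl z (xi z).1).
Proof.
move=> rX; have sc : smoothOn D (fun _ : E => 2^-1 : R) by exact: smoothOn_cst.
apply: vrep_ext (@vrep_scale _ _ M i _ (fun=> 2^-1) _ sc
  (vrep_add rX (vrep_barthel rX))) => z Dz /=.
rewrite -[LHS]/(2^-1 *: ((xi z).1 + (xi z).1),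
  2^-1 *: ((xi z).2 + (- (2%:R *: N z (xi z).1) - (xi z).2))).
rewrite addrCA subrr addr0 scalerN scalerA mulVf ?pnatr_eq0// scale1r.
by rewrite half_double.
Qed.

Lemma vrep_ver X (xi : E -> E) : vrep i X xi ->
  vrep i (ver G X) (fun z => (0, (xi z).2 + N z (xi z).1)).
Proof.
move=> rX; have sc : smoothOn D (fun _ : E => 2^-1 : R) by exact: smoothOn_cst.
apply: vrep_ext (@vrep_scale _ _ M i _ (fun=> 2^-1) _ sc
  (vrep_sub rX (vrep_barthel rX))) => z Dz /=.
rewrite -[LHS]/(2^-1 *: ((xi z).1 - (xi z).1),
  2^-1 *: ((xi z).2 - (- (2%:R *: N z (xi z).1) - (xi z).2))).
rewrite subrr scaler0 opprD !opprK addrCA scalerDr scalerA mulVf ?pnatr_eq0//.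
by rewrite scale1r half_double addrC.
Qed.

(** By [vrep_hor] the horizontal part of a field at z depends only on the base
component, so the set in the definition of beta is a singleton; it is nonempty
because some global field has base component a at z. *)
Lemma beta_chart z a : D z -> beta G (spar i z) (bdir i z.1 a) = sdir i z (hl z a).
Proof.
move=> Dz; rewrite /beta; apply: get_unique => [|xi].
  have [X [xi [sX rX xz]]] := smooth_vfield_through (a, 0) Dz.
  have hX := (vrep_hor rX).2 _ Dz; rewrite xz in hX.
  by split; [exists X|rewrite (rho_chart _ Dz)].
move=> [[X sX ->]]; have [xi' rX] := slit_vrep_exists i sX.
rewrite ((vrep_hor rX).2 _ Dz) (rho_chart _ Dz).
by move/(dirder_inj baseA (slit_fst Dz)) => /= ->.
Qed.

Lemma vrep_beta Y (a : E -> V) : prep i Y a ->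
  vrep i (betaf G Y) (fun z => hl z (a z)).
Proof.
move=> rY; split=> [|z Dz]; first exact: smooth_hlift rY.1.
by rewrite /betaf (rY.2 _ Dz) beta_chart.
Qed.

Lemma prep_K X (xi : E -> E) : vrep i X xi ->
  prep i (Kf G X) (fun z => (xi z).2 + N z (xi z).1).
Proof.
move=> rX; split=> [|z Dz].
  apply: smoothOn_add => //; first exact: smoothOn_snd_comp rX.1.
  by apply: smooth_N => //; exact: smoothOn_fst_comp rX.1.
rewrite /Kf; apply: get_unique => [|w [tw]].
  split; first exact: (dirder_tangent _ (slit_fst Dz)).
  by rewrite ((vrep_ver rX).2 _ Dz) (gamma_chart _ Dz).
have [a ->] := tangent_chart baseA (slit_fst Dz) tw.
rewrite ((vrep_ver rX).2 _ Dz) (gamma_chart _ Dz) => /(dirder_inj slitA Dz).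
by case=> ->.
Qed.

(** The derivatives of the components of X cancel, leaving the derivative of a
along xi and the bilinear term B. *)
Lemma prep_berwald X (xi : E -> E) Y (a : E -> V) : vrep i X xi -> prep i Y a ->
  prep i (berwald G X Y) (fun z => pd a z (xi z) + B z (xi z).1 (a z)).
Proof.
move=> rX rY.
have sx1 := smoothOn_fst_comp rX.1; have sa := rY.1.
have rK := prep_K rX; set k := (fun z => _) in rK.
have r1 := prep_rho (slit_vrep_bracket (vrep_gamma rK) (vrep_beta rY)).
have r2 := prep_K (slit_vrep_bracket (vrep_beta (prep_rho rX)) (vrep_gamma rY)).
have := prep_add r1 r2; apply: prep_ext => z Dz /=.
have shx := smooth_hlift oD sg sx1.
rewrite (pd_vert _ Dz sa) (pd_vert _ Dz rK.1) /=.
rewrite (pd_hlift_fst oD sg _ Dz sa) (pd_hlift_fst oD sg _ Dz sx1).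
rewrite (pd_hlift_snd oD sg _ Dz sx1) subr0 sub0r opprK.
rewrite (linear_mapN (Ncoef_linear sg Dz)) -[X in _ + X = _]addrA addrK addrA; congr (_ + _).
rewrite -(pdDr sa Dz); congr (pd a z _).
rewrite -[LHS]/(0 + (xi z).1, k z - N z (xi z).1) add0r /k addrK.
by rewrite -surjective_pairing.
Qed.

(** The components of the fields may be frozen at z: all terms in which they
are differentiated cancel, by the Leibniz rule and the symmetry of second
derivatives. *)
Lemma curvature_chart X Y Z (xi eta : E -> E) (c : E -> V) z :
  vrep i X xi -> vrep i Y eta -> prep i Z c -> D z ->
  curvature G X Y Z (spar i z) = bdir i z.1
    (pd (fun y => B y (xi z).1 (c z)) z (eta z)
     - pd (fun y => B y (eta z).1 (c z)) z (xi z)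
     + (B z (eta z).1 (B z (xi z).1 (c z)) - B z (xi z).1 (B z (eta z).1 (c z)))).
Proof.
move=> rX rY rZ Dz; have sc := rZ.1.
have key X1 Y1 (xi1 eta1 : E -> E) : vrep i X1 xi1 -> vrep i Y1 eta1 ->
    berwald G X1 (berwald G Y1 Z) (spar i z) = bdir i z.1
     (pd (fun y => pd c y (eta1 z)) z (xi1 z) + pd c z (pd eta1 z (xi1 z))
      + (pd (fun y => B y (eta1 z).1 (c z)) z (xi1 z)
         + B z (eta1 z).1 (pd c z (xi1 z)) + B z (pd eta1 z (xi1 z)).1 (c z))
      + B z (xi1 z).1 (pd c z (eta1 z) + B z (eta1 z).1 (c z))).
  move=> r1 r2; rewrite ((prep_berwald r1 (prep_berwald r2 rZ)).2 _ Dz).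
  have s1 : smoothOn D (fun y => pd c y (eta1 y)).
    by apply: smoothOn_pd => //; exact: r2.1.
  have s2 : smoothOn D (fun y => B y (eta1 y).1 (c y)).
    by apply: smooth_B => //; exact: smoothOn_fst_comp r2.1.
  rewrite (pd_add _ s1 s2 Dz) (pd_pd oD _ Dz sc r2.1).
  by rewrite (pd_B oD sg _ Dz (smoothOn_fst_comp r2.1) sc) (pd_fst_comp _ r2.1 Dz).
rewrite /curvature (key _ _ _ _ rX rY) (key _ _ _ _ rY rX).
rewrite ((prep_berwald (slit_vrep_bracket rX rY) rZ).2 _ Dz) /=.
have iz := slit_fst Dz.
rewrite -(dirderN _ iz) -!(dirderD _ _ iz); apply: (congr1 (bdir i z.1)).
rewrite (pdBr sc Dz).
rewrite (@pd_sym _ _ _ oD _ (findim_rV n) c z (eta z) (xi z) Dz sc).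
rewrite (linear_mapB (Bcoef_linearl oD sg _ Dz)).
rewrite !(linear_mapD (Bcoef_linearr sg _ Dz)).
move: (pd (fun y => pd c y (xi z)) z (eta z)) => t1.
move: (pd c z (pd eta z (xi z))) (pd c z (pd xi z (eta z))) => t2 t3.
move: (B z (pd eta z (xi z)).1 (c z)) (B z (pd xi z (eta z)).1 (c z)) => t4 t5.
move: (B z (eta z).1 (pd c z (xi z))) (B z (xi z).1 (pd c z (eta z))) => t6 t7.
move: (pd _ _ _) (pd _ _ _) (B _ _ (B _ _ _)) (B _ _ (B _ _ _)) => t8 t9 s1 s2.
by apply/rowP => l; rewrite !mxE; ring.
Qed.

Lemma hcurv_chart X Y Z (a b c : E -> V) z :
  prep i X a -> prep i Y b -> prep i Z c -> D z ->
  hcurv G X Y Z (spar i z) = bdir i z.1 (curv_coef g z (a z) (b z) (c z)).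
Proof.
move=> rX rY rZ Dz.
by rewrite /hcurv (curvature_chart (vrep_beta rX) (vrep_beta rY) rZ Dz).
Qed.

End BerwaldChart.

(** * Projective change of the spray *)
Section ProjectiveCalculus.
Context {R : realType} {n : nat}.
#[local] Notation V := 'rV[R]_n.
#[local] Notation E := ('rV[R]_n * 'rV[R]_n)%type.
#[local] Notation fE := (@findim_prod R _ _ (findim_rV n) (findim_rV n)).

Variables (D : set E) (g : E -> V) (l : E -> R).
Hypotheses (oD : open D) (sg : smoothOn D g) (sl : smoothOn D l).
Hypothesis hg : forall z, D z -> pd g z (0, z.2) = 2%:R *: g z.
Hypothesis hl : forall z, D z -> pd l z (0, z.2) = l z.

#[local] Notation N := (Ncoef g).
#[local] Notation B := (Bcoef g).
#[local] Notation h := (hlift g).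

Definition projective_coef (z : E) : V := g z + l z *: z.2.
(** The form Q in a chart: h z a is the lift of a, and the derivative of l
along (0, a) is alpha(a). *)
Definition Qcoef (z : E) (a : V) : R := pd l z (h z a) - l z * pd l z (0, a).

#[local] Notation g' := projective_coef.
#[local] Notation dvl z a := (pd l z (0, a)).

Let sc (W : normedModType R) (w : W) : smoothOn D (fun _ : E => w).
Proof. exact: smoothOn_cst. Qed.

Let ssnd : smoothOn D (snd : E -> V).
Proof. exact: smoothOn_snd. Qed.

Lemma smooth_projective_coef : smoothOn D g'.
Proof. by apply: smoothOn_add => //; apply: smoothOn_scale => //; exact: ssnd. Qed.

Lemma pd_projective_coef z w : D z ->
  pd g' z w = pd g z w + (l z *: w.2 + pd l z w *: z.2).
Proof.
move=> Dz; rewrite (pd_add _ sg (smoothOn_scale oD sl ssnd) Dz).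
by rewrite (pd_scale _ sl ssnd Dz) pd_snd.
Qed.

Lemma projective_coef_homogeneous z : D z -> pd g' z (0, z.2) = 2%:R *: g' z.
Proof.
move=> Dz; rewrite (pd_projective_coef _ Dz) (hg Dz) (hl Dz) /=.
by rewrite /projective_coef scalerDr; congr (_ + _); rewrite scaler_nat mulr2n.
Qed.

Lemma smooth_factor_vertical a : smoothOn D (fun y => dvl y a).
Proof. exact: smoothOn_pd_const. Qed.

Lemma smooth_hlift_const b : smoothOn D (fun y => h y b).
Proof. by apply: smooth_hlift => //; exact: sc. Qed.

Lemma Qcoef_linear z : D z -> linear (Qcoef z).
Proof.
move=> Dz k a b; rewrite /Qcoef (hlift_linear sg Dz) vert_linear.
rewrite !(pd_linear sl Dz) /GRing.scale /=; ring.
Qed.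

Lemma smooth_Q (b : E -> V) : smoothOn D b -> smoothOn D (fun y => Qcoef y (b y)).
Proof.
move=> sb; apply: smoothOn_minus => //.
  by apply: smoothOn_pd => //; exact: smooth_hlift.
apply: smoothOn_scale => //; apply: smoothOn_pd => //; exact: smooth_vert.
Qed.

Lemma pd_hlift_const z b w : D z -> pd (fun y => h y b) z w
  = (0, - pd (fun y => N y b) z w).
Proof.
move=> Dz; rewrite [LHS]surjective_pairing (pd_hlift_fst oD sg _ Dz (sc b)).
by rewrite (pd_hlift_snd oD sg _ Dz (sc b)) pd_cst (linear_map0 (Ncoef_linear sg Dz)) addr0.
Qed.

(** All terms but the first are symmetric in a and b, so they disappear from
the antisymmetrised derivative of Q. *)
Lemma pd_Qcoef z a b : D z ->
  pd (fun y => Qcoef y b) z (0, a)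
  = pd (fun y => dvl y a) z (h z b)
    - (dvl z (B z b a) + (l z * pd (fun y => dvl y b) z (0, a) + dvl z a * dvl z b)).
Proof.
move=> Dz.
have s1 : smoothOn D (fun y => pd l y (h y b)).
  by apply: smoothOn_pd => //; exact: smooth_hlift_const.
have s2 : smoothOn D (fun y => l y *: dvl y b).
  by apply: smoothOn_scale => //; exact: smooth_factor_vertical.
rewrite (pd_sub _ s1 s2 Dz) (pd_scale _ sl (smooth_factor_vertical b) Dz).
rewrite (@pd_pd _ _ _ oD _ fE _ _ z _ Dz sl (smooth_hlift_const b)) (pd_hlift_const _ _ Dz).
rewrite -[pd (fun y => N y b) z (0, a)]/(B z b a).
have -> : (0, - B z b a) = - (0, B z b a) :> E.
  by rewrite -[RHS]/(- 0, - B z b a) oppr0.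
rewrite (pdNr sl Dz) (@pd_sym _ _ _ oD _ (findim_R R) _ _ _ _ Dz sl).
rewrite /GRing.scale /=; ring.
Qed.

(** The vertical derivative of a function of degree 1 has degree 0. *)
Lemma factor_vertical_homogeneous z a : D z -> pd (fun y => dvl y a) z (0, z.2) = 0.
Proof.
move=> Dz; rewrite (@pd_sym _ _ _ oD _ (findim_R R) _ _ _ _ Dz sl).
have := @pd_pd _ _ _ oD _ fE _ _ z (0, a) Dz sl (euler_field_smooth oD).
rewrite (pd_euler_field _ oD Dz) (@pd_eq _ _ _ oD _ _ l _ _ Dz hl) /=.
by rewrite -{1}(add0r (dvl z a)) => /addIr.
Qed.

Lemma Ncoef_projective z a : D z ->
  Ncoef g' z a = N z a + (l z *: a + dvl z a *: z.2).
Proof. by move=> Dz; rewrite /Ncoef (pd_projective_coef _ Dz). Qed.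

(** The new lift differs from the old one by multiples of (0, b) and (0, y);
the derivatives along (0, y) are given by homogeneity. *)
Lemma pd_Ncoef_projective z a b : D z ->
  pd (fun y => Ncoef g' y a) z (hlift g' z b) =
    pd (fun y => N y a) z (h z b) - (l z *: B z a b + dvl z b *: N z a)
    + (Qcoef z b - dvl z b * l z) *: a
    + (pd (fun y => dvl y a) z (h z b) - l z * pd (fun y => dvl y a) z (0, b)) *: z.2
    - dvl z a *: (N z b + (l z *: b + dvl z b *: z.2)).
Proof.
move=> Dz.
have sN := smooth_N_const sg a.
have s1 := smoothOn_scale oD sl (sc a).
have s2 := smoothOn_scale oD (smooth_factor_vertical a) ssnd.
rewrite (@pd_eq _ _ _ oD _ _ (fun y => N y a + (l y *: a + dvl y a *: y.2)) _ _ Dz);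
  last by move=> y Dy; rewrite (Ncoef_projective _ Dy).
rewrite (pd_add _ sN (smoothOn_add oD s1 s2) Dz) (pd_add _ s1 s2 Dz).
rewrite (pd_scale _ sl (sc a) Dz) pd_cst scaler0 add0r.
rewrite (pd_scale _ (smooth_factor_vertical a) ssnd Dz) pd_snd.
have hE : hlift g' z b = h z b - (l z *: (0, b) + dvl z b *: (0, z.2)).
  rewrite /hlift Ncoef_projective//.
  rewrite -[RHS]/(b - (l z *: 0 + dvl z b *: 0), - N z b - (l z *: b + dvl z b *: z.2)).
  by rewrite !scaler0 addr0 subr0 opprD.
have -> : (hlift g' z b).2 = - (N z b + (l z *: b + dvl z b *: z.2)).
  by rewrite /hlift /= Ncoef_projective.
have spl (W : normedModType R) (f : E -> W) : smoothOn D f ->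
   pd f z (hlift g' z b) = pd f z (h z b) -
     (l z *: pd f z (0, b) + dvl z b *: pd f z (0, z.2)).
  by move=> sf; rewrite hE (pdBr sf Dz) (pdDr sf Dz) !(pdZr sf Dz).
rewrite (spl _ _ sN) (spl _ _ sl) (spl _ _ (smooth_factor_vertical a)).
rewrite (factor_vertical_homogeneous _ Dz) (hl Dz).
rewrite -[pd (fun y => N y a) z (0, b)]/(B z a b).
rewrite -[pd (fun y => N y a) z (0, z.2)]/(B z a z.2).
rewrite (Ncoef_homogeneous oD sg hg _ Dz).
have -> : pd l z (h z b) = Qcoef z b + l z * dvl z b by rewrite /Qcoef subrK.
move: (pd _ z (h z b)) (pd _ z (h z b)) (pd _ z (0, b)) => t1 t2 t3.
by apply/rowP => k; rewrite !mxE /GRing.scale /=; ring.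
Qed.

(** Antisymmetrising [pd_Ncoef_projective] kills every term that is symmetric
in a and b. *)
Lemma curv_hat_projective z a b : D z ->
  curv_hat g' z a b = curv_hat g z a b + (Qcoef z b *: a - Qcoef z a *: b)
    + (pd (fun y => Qcoef y b) z (0, a) - pd (fun y => Qcoef y a) z (0, b)) *: z.2.
Proof.
move=> Dz; rewrite /curv_hat !pd_Ncoef_projective// !pd_Qcoef//.
rewrite (Bcoef_sym oD sg b a Dz).
rewrite (@pd_sym _ _ _ oD _ (findim_R R) _ z (0, b) (0, a) Dz sl).
move: (pd _ z (h z b)) (pd _ z (h z b)) (pd _ z (h z a)) (pd _ z (h z a)) => t1 t2 t3 t4.
by apply/rowP => k; rewrite !mxE; ring.
Qed.

End ProjectiveCalculus.

(** * The Weyl torsion tensor *)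
Section ProjectiveChange.
Context {R : realType} {n : nat} (M : manifold R n).

#[local] Notation V := 'rV[R]_n.
#[local] Notation E := ('rV[R]_n * 'rV[R]_n)%type.
#[local] Notation sdom := (@pdom R (slit M)).
#[local] Notation spar := (@param R (slit M)).
#[local] Notation bdir := (@dirder R (base M)).
#[local] Notation slitA := (atlas_slit M).
#[local] Notation baseA := (atlas_base M).

Variables (L L' : M * der (base M) -> R) (G G' : vfield (slit M)).
Variable lambda : M * der (base M) -> R.
Hypothesis hproj : projective_change L L' G G' lambda.
Hypothesis hQ : forall X : pifield M, smooth_pifield X ->
  forall u, points (P := slit M) u ->
  Qform G lambda X u = (n%:R + 1)^-1 * R1 G X u.

Lemma R1_Qform X u : smooth_pifield X -> points (P := slit M) u ->
  R1 G X u = (n%:R + 1) * Qform G lambda X u.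
Proof.
move=> sX pu; rewrite hQ// mulrA divff ?mul1r//.
Qed.

Lemma spray_exists i : exists g : E -> V, [/\ smoothOn (sdom i) g,
  forall z, sdom i z -> pd g z (0, z.2) = 2%:R *: g z &
  vrep i G (fun z => (z.2, - (2%:R *: g z)))].
Proof. exact: (spray_coefficients (change_finsler hproj) i (change_spray hproj)). Qed.

Section Chart.
Variables (i : pix (slit M)) (g : E -> V).
#[local] Notation D := (sdom i).
#[local] Notation l := (lambda \o spar i).
Hypothesis sg : smoothOn D g.
Hypothesis hg : forall z, D z -> pd g z (0, z.2) = 2%:R *: g z.
Hypothesis rG : vrep i G (fun z => (z.2, - (2%:R *: g z))).
#[local] Notation Q := (Qcoef g l).
#[local] Notation g' := (projective_coef g l).

Let oD : open D := @sdom_open _ _ M i.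

Lemma factor_smoothOn : smoothOn D l.
Proof. apply: smooth_at_smoothOn; exact: factor_smooth hproj. Qed.

Lemma factor_euler z : D z -> pd l z (0, z.2) = l z.
Proof.
move=> Dz; rewrite (euler_homogeneous (k := 1) factor_smoothOn _ Dz) ?mul1r//.
move=> u pu c c0; rewrite expr1.
exact: (factor_homogeneous hproj (slit_tbundle pu) c0).
Qed.

Lemma vrep_change : vrep i G' (fun z => (z.2, - (2%:R *: g' z))).
Proof.
have rC := vrep_gamma (prep_eta i).
have s2l : smoothOn D ((fun u => 2 * lambda u) \o spar i).
  by apply: (smoothOn_scale oD _ factor_smoothOn); exact: smoothOn_cst.
have r := vrep_sub rG (vrep_scale s2l rC).
split.
  apply: smoothOn_pair => //; first exact: smoothOn_snd.
  apply: smoothOn_opp => //; apply: smoothOn_scale => //; first exact: smoothOn_cst.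
  exact: (smooth_projective_coef oD sg factor_smoothOn).
move=> z Dz; rewrite (change_eq hproj (sdom_points Dz)).
rewrite [LHS](r.2 _ Dz); apply: (congr1 (@dirder R (slit M) i z)).
rewrite -[LHS]/(z.2 - (2 * l z) *: 0, - (2%:R *: g z) - (2 * l z) *: z.2).
rewrite scaler0 subr0; apply: (congr2 pair) => //.
by rewrite /projective_coef scalerDr opprD scalerA.
Qed.

Lemma Qform_chart X (a : E -> V) z : prep i X a -> D z ->
  Qform G lambda X (spar i z) = Q z (a z).
Proof.
move=> rX Dz; have rb := vrep_beta sg rG rX.
have sl : smooth_at (P := slit M) (spar i z) lambda.
  by apply: (factor_smooth hproj); exact: sdom_points.
rewrite /Qform (vrep_apply rb Dz sl) /alpha.
by rewrite (d_J_chart (factor_smooth hproj) rb Dz).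
Qed.

(** Makes the identity between R_1 and Q applicable to the covariant derivative
that occurs in W_2. *)
Lemma smooth_berwald_vertical X Y : smooth_pifield X -> smooth_pifield Y ->
  smooth_pifield (berwald G (gammaf X) Y).
Proof.
move=> sX sY; apply: smooth_pifield_charts => j.
have [gj [sgj _ rGj]] := spray_exists j.
have rX := prep_exists j sX; have rY := prep_exists j sY.
by eexists; exact: (prep_berwald sgj rGj (vrep_gamma rX) rY).
Qed.

(** Since Q is linear over functions, the covariant derivative subtracts exactly
the derivative of the components of Y. *)
Lemma berwald_form_R1 X Y (a b : E -> V) z :
  smooth_pifield X -> smooth_pifield Y -> prep i X a -> prep i Y b -> D z ->
  berwald_form G (gammaf X) (R1 G) Y (spar i z)
  = (n%:R + 1) * pd (fun y => Q y (b z)) z (0, a z).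
Proof.
move=> sX sY rX rY Dz; rewrite /berwald_form.
have sl := factor_smoothOn.
rewrite (R1_Qform (smooth_berwald_vertical sX sY) (sdom_points Dz)).
rewrite (Qform_chart (prep_berwald sg rG (vrep_gamma rX) rY) Dz) /=.
rewrite (linear_map0 (Bcoef_linearl oD sg _ Dz)) addr0.
have RE y : D y -> (R1 G Y \o spar i) y = (n%:R + 1) *: Q y (b y).
  by move=> Dy; rewrite /= (R1_Qform sY (sdom_points Dy)) (Qform_chart rY Dy).
have sQb := smooth_Q oD sg sl rY.1.
have sR : smoothOn D (R1 G Y \o spar i).
  apply: (smoothOn_eq (f := fun y => (n%:R + 1) *: Q y (b y))) => //.
    by move=> y Dy; rewrite RE.
  by apply: smoothOn_scale => //; exact: smoothOn_cst.
rewrite (vrep_apply (vrep_gamma rX) Dz); last exact: (smooth_at_chart slitA oD).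
rewrite (pd_eq oD _ Dz RE) (pd_scalec _ _ sQb Dz).
rewrite (pd_family oD (F := Q) _ Dz); first last.
- exact: rY.1.
- by move=> v; apply: (smooth_Q oD sg sl); exact: smoothOn_cst.
- by move=> y Dy; exact: (Qcoef_linear sg sl).
by rewrite scalerDr addrK.
Qed.

(** After R_1 is replaced by (n + 1) Q, the tensor W_2 is the right-hand side of
[curv_hat_projective]. *)
Lemma weyl_torsion_chart X Y (a b : E -> V) z :
  smooth_pifield X -> smooth_pifield Y -> prep i X a -> prep i Y b -> D z ->
  weyl_torsion G X Y (spar i z) = bdir i z.1 (curv_hat g' z (a z) (b z)).
Proof.
move=> sX sY rX rY Dz; rewrite /weyl_torsion /hcurv_hat.
rewrite (hcurv_chart sg rG rX rY (prep_eta i) Dz) (curv_coef_hat oD sg hg _ _ Dz).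
rewrite !(berwald_form_R1 _ _ rX rY Dz, berwald_form_R1 _ _ rY rX Dz)//.
rewrite !R1_Qform//; try exact: sdom_points.
rewrite (Qform_chart rX Dz) (Qform_chart rY Dz).
rewrite (rX.2 _ Dz) (rY.2 _ Dz) ((prep_eta i).2 _ Dz).
rewrite (curv_hat_projective oD sg factor_smoothOn hg factor_euler _ _ Dz).
have iz := slit_fst Dz.
rewrite -!(dirderZ _ _ iz) -!(dirderD _ _ iz) -(dirderB _ _ iz) -(dirderZ _ _ iz).
rewrite -(dirderD _ _ iz); apply: (congr1 (bdir i z.1)).
have n1 : (n%:R + 1 : R) != 0.
  by rewrite -[1]/(1%:R) -natrD pnatr_eq0 addn1.
rewrite -!addrA; congr (_ + _).
apply/rowP => k; rewrite !mxE; field; exact: n1.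
Qed.

End Chart.
End ProjectiveChange.

Theorem theorem5p9 (R : realType) (n : nat) (hn : (2 < n)%N)
    (M : manifold R n) (L L' : M * der (base M) -> R)
    (G G' : vfield (slit M)) (lambda : M * der (base M) -> R)
    (hproj : projective_change L L' G G' lambda)
    (hQ : forall X : pifield M, smooth_pifield X ->
       forall u, points (P := slit M) u ->
       Qform G lambda X u = (n%:R + 1)^-1 * R1 G X u) :
  hcurv_vanishes G' <-> weyl_torsion_vanishes G.
Proof.
split=> [H X Y sX sY u [i [z [Dz <-]]]|W X Y Z sX sY sZ u [i [z [Dz <-]]]].
  have [g [sg hg rG]] := spray_exists hproj i.
  have rX := prep_exists i sX; have rY := prep_exists i sY.
  have rG' := vrep_change hproj sg rG.
  have oD := @sdom_open _ _ M i.
  have sl := factor_smoothOn hproj i.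
  have hl := factor_euler hproj (i := i).
  have sg' := smooth_projective_coef oD sg sl.
  have hg' := projective_coef_homogeneous oD sg sl hg hl.
  rewrite (weyl_torsion_chart hproj hQ sg hg rG sX sY rX rY Dz).
  rewrite -(curv_coef_hat oD sg' hg' _ _ Dz).
  rewrite -(hcurv_chart sg' rG' rX rY (prep_eta i) Dz).
  exact: (H _ _ _ sX sY (@smooth_eta R n M) _ (sdom_points Dz)).
have [g [sg hg rG]] := spray_exists hproj i.
have rX := prep_exists i sX; have rY := prep_exists i sY; have rZ := prep_exists i sZ.
have rG' := vrep_change hproj sg rG.
have oD := @sdom_open _ _ M i.
have sl := factor_smoothOn hproj i.
have sg' := smooth_projective_coef oD sg sl.
(* Each pair of vectors at each point is reached by global pi-vector fields,
   so W_2 = 0 makes the torsion of the new spray vanish identically and it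
   can be differentiated. *)
have hat0 y a b : @pdom R (slit M) i y ->
    curv_hat (projective_coef g (lambda \o @param R (slit M) i)) y a b = 0.
  move=> Dy; have iy := slit_fst Dy.
  have [X1 [a1 [sX1 rX1 <-]]] := smooth_pifield_through a Dy.
  have [Y1 [b1 [sY1 rY1 <-]]] := smooth_pifield_through b Dy.
  apply: (dirder_inj (atlas_base M) iy); rewrite (dirder0 iy).
  rewrite -(weyl_torsion_chart hproj hQ sg hg rG sX1 sY1 rX1 rY1 Dy).
  exact: (W _ _ sX1 sY1 _ (sdom_points Dy)).
rewrite (hcurv_chart sg' rG' rX rY rZ Dz) -(pd_curv_hat oD sg' _ _ _ Dz).
rewrite (@pd_eq _ _ _ oD _ _ (fun _ => 0) _ _ Dz); last by move=> y; exact: hat0.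
by rewrite pd_cst (dirder0 (slit_fst Dz)).
Qed.
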